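(* Let $p$ be an odd prime and let $G \in \mathscr{C}_{\mathrm{reg}}$. Then there exist uncountably many $\mathrm{Aut}(G)$-orbits of weakly maximal subgroups of $G$, all distinct from the $\mathrm{Aut}(G)$-orbits of parabolic subgroups under any branch action of $G$ on any spherically homogeneous rooted tree.
   Context: Let $p$ be an odd prime. $T$ is the regular $p$-adic rooted tree: its vertices $u_\omega$ are indexed by the finite words $\omega$ over $X=\{1,\ldots,p\}$, the root being the empty word, with an edge from $u_\omega$ to $u_{\omega x}$ for each $x\in X$. Automorphisms act on the right. $\psi_1\colon \mathrm{Stab}_{\mathrm{Aut}(T)}(1)\to \mathrm{Aut}(T)\times\overset{p}{\ldots}\times\mathrm{Aut}(T)$ is the natural isomorphism from the pointwise stabiliser of the first level, given by restriction to the subtrees rooted at the first-level vertices $u_1,\ldots,u_p$ (each naturally identified with $T$). Let $a$ be the rooted automorphism that permutes the first-level vertices (with their subtrees) according to the $p$-cycle $(1\;2\;\ldots\;p)$. A datum $\mathbf{E}=(\mathbf{E}^{(1)},\ldots,\mathbf{E}^{(p)})$ consists, for each $j\in\{1,\ldots,p\}$, of an integer $r_j\in\{0,\ldots,p-1\}$, with $r_j\neq 0$ for at least one $j$, and an $r_j$-tuple $\mathbf{E}^{(j)}=(\mathbf{e}^{(j)}_1,\ldots,\mathbf{e}^{(j)}_{r_j})$ of linearly independent vectors $\mathbf{e}^{(j)}_i=(e^{(j)}_{i,1},\ldots,e^{(j)}_{i,p-1})\in(\mathbb{Z}/p\mathbb{Z})^{p-1}$. The generalised multi-edge spinal group in standard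 form associated to $\mathbf{E}$ is $G_{\mathbf{E}}=\langle \{a\}\cup\{b^{(j)}_i\mid 1\le j\le p,\,1\le i\le r_j\}\rangle$, where $b^{(j)}_i\in\mathrm{Stab}_{\mathrm{Aut}(T)}(1)$ is defined recursively by $$\psi_1(b^{(j)}_i)=\big(a^{e^{(j)}_{i,j}},\ldots,a^{e^{(j)}_{i,p-1}},b^{(j)}_i,a^{e^{(j)}_{i,1}},\ldots,a^{e^{(j)}_{i,j-1}}\big),$$ with $b^{(j)}_i$ in coordinate $p-j+1$. $\mathscr{C}_{\mathrm{reg}}$ is the class of subgroups of $\mathrm{Aut}(T)$ that are conjugate in $\mathrm{Aut}(T)$ to some $G_{\mathbf{E}}$ such that for every $j$ with $r_j\neq 0$ at least one of the vectors $\mathbf{e}^{(j)}_1,\ldots,\mathbf{e}^{(j)}_{r_j}$ is not of the form $(\alpha,\ldots,\alpha)$ with $\alpha\in\mathbb{Z}/p\mathbb{Z}$. A subgroup of $G$ is weakly maximal if it is maximal among the subgroups of infinite index in $G$. A spherically homogeneous rooted tree is an infinite rooted tree in which all vertices of the same level have the same finite out-degree, at least $2$. A branch action of $G$ on such a tree $T'$ is a faithful action by automorphisms which is transitive on each level and such that for every $n$ the subgroup generated by the rigid stabilisers of the level-$n$ vertices (the rigid stabiliser of $u$ being the subgroup of elements fixing all vertices outside the subtree rooted at $u$) has finite index in $G$. The parabolic subgroups of $G$ with respect to such an action are the stabilisers in $G$ of points of the boundary $\partial T'$ (the set of infinite rooted paths). *)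

(* Defs.v *)
From HB Require Import structures.
From mathcomp Require Import all_boot all_algebra.
From mathcomp Require Import boolp classical_sets functions cardinality.

Set Implicit Arguments.
Unset Strict Implicit.
Unset Printing Implicit Defensive.

Local Open Scope classical_set_scope.
Local Open Scope group_scope.

Section Subgroups.
Variable gT : groupType.
Implicit Types (G H K S : set gT) (x g : gT).

Definition is_subgroup H : Prop := group_closed [in H].

Lemma is_subgroupP H :
  is_subgroup H <->
  [/\ H 1, forall x y, H x -> H y -> H (x * y) & forall x, H x -> H x^-1].
Proof.
split=> [gH|[H1 HM HV]].
  split; first by have [/set_mem] := gH.
    move=> x y /mem_set Hx /mem_set Hy; apply/set_mem.
    exact: (group_closedM gH).
  move=> x /mem_set Hx; apply/set_mem.
  exact: (group_closedV gH).
split; first exact/mem_set.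
move=> x y /set_mem Hx /set_mem Hy; apply/mem_set.
exact/HM/HV.
Qed.

Definition generated S : set gT := smallest is_subgroup S.

Definition right_coset H x : set gT := [set h * x | h in H].

Definition finite_index G H : Prop := finite_set [set right_coset H x | x in G].

Definition infinite_index_subgroup G H : Prop :=
  [/\ is_subgroup H, H `<=` G & ~ finite_index G H].

Definition weakly_maximal G H : Prop :=
  infinite_index_subgroup G H /\
  forall K, infinite_index_subgroup G K -> H `<=` K -> K = H.

Definition conjugate S g : set gT := [set x ^ g | x in S].

(* Only the restriction of [phi] to [G] is meaningful. *)
Definition is_group_aut G (phi : gT -> gT) : Prop :=
  set_bij G G phi /\
  forall x y, G x -> G y -> phi (x * y) = phi x * phi y.

Definition aut_orbit G H : set (set gT) :=
  [set phi @` H | phi in [set phi | is_group_aut G phi]].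

End Subgroups.

(* The edges join each vertex other than the root to its parent; by convention
   the parent of the root is the root itself (this is forced by the axioms). *)
Record rootedTree := RootedTree {
  vertex :> Type;
  root : vertex;
  parent : vertex -> vertex;
  level : vertex -> nat;
  level_eq0 : forall v, level v = 0%N <-> v = root;
  level_parent : forall v, level (parent v) = (level v).-1
}.

Arguments root {r}.

Definition children (T : rootedTree) (u : T) : set T :=
  [set v | v <> root /\ parent v = u].

Definition descendants (T : rootedTree) (u : T) : set T :=
  [set v | exists n, iter n (@parent T) v = u].

Definition spherically_homogeneous (T : rootedTree) : Prop :=
  exists m : nat -> nat,
    (forall n, 2 <= m n) /\ forall v : T, (children v #= `I_(m (level v)))%card.

Definition boundary (T : rootedTree) : set (nat -> T) :=
  [set xi | xi 0%N = root /\ forall n, children (xi n) (xi n.+1)].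

(* Commuting with [parent] amounts to fixing the root and preserving edges:
   see [tree_aut_root] and [tree_aut_children]. *)
Record tree_aut (T : rootedTree) := TreeAut {
  aut_fun :> T -> T;
  aut_inv : T -> T;
  aut_funK : cancel aut_fun aut_inv;
  aut_invK : cancel aut_inv aut_fun;
  aut_parent : forall v, aut_fun (parent v) = parent (aut_fun v)
}.

Section TreeAutGroup.
Variable T : rootedTree.
Implicit Types (f g h : tree_aut T) (u v : T).

Lemma parent_root : parent root = root :> T.
Proof.
by apply/level_eq0; rewrite level_parent; have /level_eq0-> := erefl (@root T).
Qed.

Lemma parent_fixed v : parent v = v -> v = root.
Proof.
move=> pv; apply/level_eq0; have := level_parent v; rewrite pv.
by case: (level v) => //= n /eqP; rewrite eqn_leq ltnn.
Qed.

Lemma tree_aut_root f : f root = root.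
Proof. by apply: parent_fixed; rewrite -aut_parent parent_root. Qed.

Lemma tree_aut_children f u v : children u v <-> children (f u) (f v).
Proof.
split=> -[v0 pv]; split.
- move=> fv; apply: v0; apply: (can_inj (aut_funK f)).
  by rewrite fv tree_aut_root.
- by rewrite -aut_parent pv.
- by move=> vr; apply: v0; rewrite vr tree_aut_root.
- by apply: (can_inj (aut_funK f)); rewrite aut_parent.
Qed.

Lemma tree_autP f g : (forall v, f v = g v) -> f = g.
Proof.
case: f g => [f f' fK f'K fp] [g g' gK g'K gp] /= /funext fg.
rewrite {}fg in fK f'K fp *.
have fg' : f' = g' by apply: funext => v; rewrite -{1}(g'K v) fK.
rewrite {}fg' in fK f'K *.
by congr TreeAut; exact: Prop_irrelevance.
Qed.

Definition taut_one : tree_aut T :=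
  @TreeAut T id id (frefl _) (frefl _) (fun=> erefl).

Lemma taut_inv_parent f v : aut_inv f (parent v) = parent (aut_inv f v).
Proof. by apply: (can_inj (aut_funK f)); rewrite aut_parent !aut_invK. Qed.

Definition taut_inv f : tree_aut T :=
  TreeAut (aut_invK f) (aut_funK f) (taut_inv_parent f).

Lemma taut_mul_parent f g v : (g \o f) (parent v) = parent ((g \o f) v).
Proof. by rewrite /= !aut_parent. Qed.

(* Automorphisms act on the right: in [f * g], [f] is applied first. *)
Definition taut_mul f g : tree_aut T :=
  TreeAut (can_comp (aut_funK g) (aut_funK f))
          (can_comp (aut_invK f) (aut_invK g)) (taut_mul_parent f g).

Lemma taut_mulA : associative taut_mul.
Proof. by move=> f g h; apply: tree_autP. Qed.

Lemma taut_mul1 : left_id taut_one taut_mul.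
Proof. by move=> f; apply: tree_autP. Qed.

Lemma taut_mulr1 : right_id taut_one taut_mul.
Proof. by move=> f; apply: tree_autP. Qed.

Lemma taut_mulV : left_inverse taut_one taut_inv taut_mul.
Proof. by move=> f; apply: tree_autP => v /=; rewrite aut_invK. Qed.

Lemma taut_mulrV : right_inverse taut_one taut_inv taut_mul.
Proof. by move=> f; apply: tree_autP => v /=; rewrite aut_funK. Qed.

HB.instance Definition _ := gen_eqMixin (tree_aut T).
HB.instance Definition _ := gen_choiceMixin (tree_aut T).
HB.instance Definition _ := isGroup.Build (tree_aut T)
  taut_mulA taut_mul1 taut_mulr1 taut_mulV taut_mulrV.

End TreeAutGroup.

Section BranchAction.
Variables (gT : groupType) (G : set gT) (T : rootedTree).
(* Only the restriction of [alpha] to [G] is meaningful. *)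
Variable alpha : gT -> tree_aut T.

Definition faithful_action : Prop :=
  (forall x y, G x -> G y -> alpha (x * y) = alpha x * alpha y) /\
  (forall x, G x -> (forall v, alpha x v = v) -> x = 1).

Definition level_transitive : Prop :=
  forall u v : T, level u = level v -> exists2 x, G x & alpha x u = v.

Definition rigid_stabiliser (u : T) : set gT :=
  [set x | G x /\ forall v, ~ descendants u v -> alpha x v = v].

Definition rigid_level_stabiliser (n : nat) : set gT :=
  generated (\bigcup_(u in [set u : T | level u = n]) rigid_stabiliser u).

Definition branch_action : Prop :=
  [/\ faithful_action, level_transitive &
      forall n, finite_index G (rigid_level_stabiliser n)].

Definition parabolic (xi : nat -> T) : set gT :=
  [set x | G x /\ forall n, alpha x (xi n) = xi n].

End BranchAction.

Section RegularTree.
Variable p : nat.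

Definition word_parent (w : seq 'I_p) : seq 'I_p := take (size w).-1 w.

Lemma word_level_eq0 (w : seq 'I_p) : size w = 0%N <-> w = [::].
Proof. by case: w. Qed.

Lemma word_level_parent (w : seq 'I_p) : size (word_parent w) = (size w).-1.
Proof. by rewrite size_takel ?leq_pred. Qed.

(* The letters 1, ..., p are represented by 0, ..., p - 1 in ['I_p]. *)
Definition regular_tree : rootedTree :=
  RootedTree word_level_eq0 word_level_parent.

Lemma word_parent_rcons w x : word_parent (rcons w x) = w.
Proof. by rewrite /word_parent size_rcons -cats1 take_size_cat. Qed.

Lemma word_parent_cons x w :
  word_parent (x :: w) = if w is [::] then [::] else x :: word_parent w.
Proof. by case: w. Qed.

Definition rooted_fun (s : 'I_p -> 'I_p) (w : regular_tree) : regular_tree :=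
  if w is x :: w' then s x :: w' else [::].

Lemma rooted_funK s t : cancel s t -> cancel (rooted_fun s) (rooted_fun t).
Proof. by move=> sK [|x w] //=; rewrite sK. Qed.

Lemma rooted_fun_parent s w :
  rooted_fun s (parent w) = parent (rooted_fun s w).
Proof. by case: w => [|x [|y w]]. Qed.

(* The rooted automorphism permuting the first level as (1 2 ... p). *)
Definition rooted_a : tree_aut regular_tree :=
  TreeAut (rooted_funK (@ordSK p)) (rooted_funK (@ord_predK p))
          (rooted_fun_parent (@ordS p)).

(* The automorphism of the first level stabiliser with section [c x] at the
   first-level vertex [x], where [None] stands for the automorphism itself. *)
Fixpoint spinal_fun (c : 'I_p -> option (tree_aut regular_tree))
    (w : seq 'I_p) : seq 'I_p :=
  if w is x :: w' then
    x :: (if c x is Some g then g w' else spinal_fun c w')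
  else [::].

Lemma spinal_funK (c c' : 'I_p -> option (tree_aut regular_tree)) :
  (forall x, match c x, c' x with
             | Some g, Some h => cancel g h
             | None, None => True
             | _, _ => False
             end) ->
  cancel (spinal_fun c) (spinal_fun c').
Proof.
move=> cc' ; elim=> [|x w IHw] //=.
by move: (cc' x); case: (c x) (c' x) => [g|] [h|] // gK; rewrite ?gK ?IHw.
Qed.

Lemma spinal_fun_parent c (w : regular_tree) :
  spinal_fun c (parent w) = parent (spinal_fun c w : regular_tree).
Proof.
rewrite /= ; elim: w => [|x w IHw] //.
rewrite word_parent_cons [in RHS]/= word_parent_cons.
case: w IHw => [|y w] IHw.
  by case: (c x) => // g; rewrite (tree_aut_root g).
have -> : forall u, spinal_fun c (x :: u) =
    x :: (if c x is Some g then g u else spinal_fun c u) by [].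
case: (c x) => [g|]; last by rewrite IHw.
have := aut_parent g (y :: w); rewrite /= => ->.
case E: (aut_fun g (y :: w)) => [|z u] //.
have /(can_inj (aut_funK g)) // : g (y :: w) = g root.
by rewrite tree_aut_root.
Qed.

Definition spinal_inv (c : 'I_p -> option (tree_aut regular_tree)) x :=
  omap (@taut_inv regular_tree) (c x).

Lemma spinal_funKV c : cancel (spinal_fun c) (spinal_fun (spinal_inv c)).
Proof.
by apply: spinal_funK => x; rewrite /spinal_inv; case: (c x) => //= g; exact: (aut_funK g).
Qed.

Lemma spinal_funVK c : cancel (spinal_fun (spinal_inv c)) (spinal_fun c).
Proof.
by apply: spinal_funK => x; rewrite /spinal_inv; case: (c x) => //= g; exact: (aut_invK g).
Qed.

Definition spinal c : tree_aut regular_tree :=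
  @TreeAut regular_tree _ _ (spinal_funKV c) (spinal_funVK c) (@spinal_fun_parent c).

Definition a_powers (e : 'rV['F_p]_p.-1) : seq (tree_aut regular_tree) :=
  [seq rooted_a ^+ e 0%R i | i <- enum 'I_p.-1].

(* The directed automorphism b defined recursively by
   psi_1(b) = (a^{e_j}, ..., a^{e_{p-1}}, b, a^{e_1}, ..., a^{e_{j-1}});
   see [directed_bE]. As for letters, the index j is shifted by one. *)
Definition directed_b (j : 'I_p) (e : 'rV['F_p]_p.-1) : tree_aut regular_tree :=
  let powers := [seq Some g | g <- a_powers e] in
  spinal (fun x => nth None (drop j powers ++ None :: take j powers) x).

Lemma directed_bE (j : 'I_p) e (x : 'I_p) (w : seq 'I_p) :
  directed_b j e (x :: w) =
  x :: nth 1 (drop j (a_powers e) ++ directed_b j e :: take j (a_powers e)) x w.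
Proof.
have lt_x : x < size (drop j (a_powers e) ++ directed_b j e :: take j (a_powers e)).
  rewrite size_cat /= addnS -size_cat size_cat addnC -size_cat cat_take_drop.
  by rewrite size_map size_enum_ord prednK ?(leq_ltn_trans (leq0n x)).
transitivity (x :: (if nth None (drop j [seq Some g | g <- a_powers e] ++
    None :: take j [seq Some g | g <- a_powers e]) x is Some g
    then g else directed_b j e) w).
  by rewrite /directed_b /=; case: (nth _ _ _).
congr (_ :: _ w); rewrite -map_drop -map_take.
move: {e} (drop _ _) (take _ _) (directed_b j e) (nat_of_ord x) lt_x => s1 s2 d.
elim: s1 => [|g s1 IHs] [|k] //=; rewrite ltnS; last exact: IHs.
by move=> lt_k; rewrite (nth_map 1).
Qed.

End RegularTree.

Section MultiEdgeSpinal.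
Variable p : nat.

(* [E j] is the tuple of vectors E^(j); its length is r_j. *)
Definition is_datum (E : 'I_p -> seq 'rV['F_p]_p.-1) : Prop :=
  [/\ forall j, size (E j) < p,
      exists j, size (E j) != 0%N &
      forall j, free (E j)].

Definition spinal_group (E : 'I_p -> seq 'rV['F_p]_p.-1) :
    set (tree_aut (regular_tree p)) :=
  generated ([set rooted_a p] `|`
    [set g | exists j, exists2 e, e \in E j & g = directed_b j e]).

Definition regular_datum (E : 'I_p -> seq 'rV['F_p]_p.-1) : Prop :=
  forall j, size (E j) != 0%N ->
    exists2 e, e \in E j & ~ exists alpha : 'F_p, e = const_mx alpha.

Definition C_reg (G : set (tree_aut (regular_tree p))) : Prop :=
  exists E, [/\ is_datum E, regular_datum E &
    exists g : tree_aut (regular_tree p), G = conjugate (spinal_group E) g].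

End MultiEdgeSpinal.

(* Main.v *)
(* In T, let F_w be the set of the p ends i w_0 w_1 w_2 ... (i a letter) and L_w
   the stabiliser of F_w in G.  L_w has infinite index, so (G being finitely
   generated) it lies in a weakly maximal subgroup H_w.  If w <> w', then F_w and
   F_w' are disjoint, so that L_w and L_w' together contain all the rigid
   stabilisers of some level; G being branch, they lie in no common subgroup of
   infinite index, whence H_w <> H_w'.  This gives uncountably many H_w, and the
   orbits of the countable group Aut(G) are countable.

   L_w contains the rooted automorphism a, which fixes no vertex of the first
   level; such an element fixes no end in any branch action of G on a tree T'.
   Indeed, let R be the product of the first-level rigid stabilisers R_u of T.
   If R_u moves a vertex v of T', then R_u contains the commutators of the
   elements of R supported below v, and this can hold for one u only since the
   R_u commute with each other.  If a fixed an end of T', then by invariance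
   under a no R_u could move a vertex of that end, so that the end would be fixed
   by R, which has finite index.

   That G is branch reduces to the finiteness of G/N, where N is the normal
   subgroup of the g such that (g, 1, ..., 1) is in psi_1(G).  The directed
   generators b commute modulo N, and comparing the commutators of two conjugates
   of the b's at their two nontrivial sections shows that the [b, a] are central
   modulo N, as soon as one exponent vector is not constant; the case of the
   vectors (u, -u) for p = 3 uses the argument known for the Gupta-Sidki group. *)
Require Import Defs.
From HB Require Import structures.
From mathcomp Require Import all_boot all_algebra.
From mathcomp Require Import boolp classical_sets functions cardinality.
From mathcomp Require Import finfield ring zify.

Local Open Scope classical_set_scope.
Local Open Scope group_scope.
Set Implicit Arguments.
Unset Strict Implicit.
Unset Printing Implicit Defensive.

(** * Subgroups of finite index *)

Section Sub.
Variable gT : groupType.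
Implicit Types (G H K S : set gT) (x y g : gT).

Lemma is_subgroup1 H : is_subgroup H -> H 1.
Proof. by case/is_subgroupP. Qed.
Lemma is_subgroupM H x y : is_subgroup H -> H x -> H y -> H (x * y).
Proof. by case/is_subgroupP => _ h _; exact: h. Qed.
Lemma is_subgroupV H x : is_subgroup H -> H x -> H x^-1.
Proof. by case/is_subgroupP => _ _ h; exact: h. Qed.
Lemma is_subgroupJ H x y : is_subgroup H -> H x -> H y -> H (x ^ y).
Proof. by move=> sH Hx Hy; apply: is_subgroupM; [|exact: is_subgroupV|exact: is_subgroupM]. Qed.
Lemma is_subgroupR H x y : is_subgroup H -> H x -> H y -> H [~ x, y].
Proof. by move=> sH Hx Hy; apply: is_subgroupM; [|exact: is_subgroupV|exact: is_subgroupJ]. Qed.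
Lemma is_subgroupX H x n : is_subgroup H -> H x -> H (x ^+ n).
Proof.
move=> sH Hx; elim: n => [|n IH]; first by rewrite expg0; exact: is_subgroup1.
by rewrite expgS; exact: is_subgroupM.
Qed.
Lemma is_subgroupMl H x y : is_subgroup H -> H x -> H (x * y) -> H y.
Proof. by move=> sH Hx Hxy; rewrite -(mulKg x y); apply: is_subgroupM => //; exact: is_subgroupV. Qed.
Lemma generated_subgroup S : is_subgroup (generated S).
Proof.
apply/is_subgroupP; split.
- by move=> H [sH _]; exact: is_subgroup1.
- by move=> x y Sx Sy H hH; apply: (is_subgroupM hH.1); [exact: Sx | exact: Sy].
- by move=> x Sx H hH; apply: (is_subgroupV hH.1); exact: Sx.
Qed.

Lemma mem_generated S x : S x -> generated S x.
Proof. by move=> Sx H [_]; exact. Qed.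

Lemma generated_min S H : is_subgroup H -> S `<=` H -> generated S `<=` H.
Proof. by move=> sH SH x; apply. Qed.

End Sub.


Section FiniteIndex.
Variable gT : groupType.
Implicit Types (G H K S : set gT) (x y g : gT).

Lemma generated_ind (S : set gT) (P : gT -> Prop) :
  P 1 -> (forall g s, P g -> S s -> P (g * s) /\ P (g * s^-1)) ->
  forall x, generated S x -> P x.
Proof.
move=> P1 PS x Sx; rewrite -[x]mul1g.
pose Q : set gT := [set x | forall g, P g -> P (g * x) /\ P (g * x^-1)].
have SQ : generated S `<=` Q; last by have [] := SQ x Sx 1 P1.
apply: generated_min => [|s Ss g Pg]; last exact: PS.
apply/is_subgroupP; split=> [g Pg|u v /= Pu Pv g Pg|u /= Pu g Pg].
- by rewrite invg1 mulg1.
- split; first by rewrite mulgA; apply: (Pv _ _).1; apply: (Pu _ _).1.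
  by rewrite invgM mulgA; apply: (Pu _ _).2; apply: (Pv _ _).2.
- by rewrite invgK; have [] := Pu g Pg.
Qed.

(** Finite index as a finite colouring of [G] in which equal colours force equal right cosets of
    [K]. It makes sense for sets not known to be subgroups, is monotone in [K], and pulls back along
    homomorphisms. *)
Definition fin_idx G K : Prop :=
  exists (I : finType) (c : gT -> I),
    forall x y, G x -> G y -> c x = c y -> K (x * y^-1).

Lemma fin_idxW G K K' : K `<=` K' -> fin_idx G K -> fin_idx G K'.
Proof.
by move=> KK [I [c cP]]; exists I, c => x y Gx Gy /(cP _ _ Gx Gy)/KK.
Qed.

Lemma fin_idx_reps G K : G 1 -> fin_idx G K ->
  exists (I : finType) (c : gT -> I) (r : I -> gT), (forall i, G (r i)) /\
    forall x, G x -> K (x * (r (c x))^-1).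
Proof.
move=> G1 [I [c cP]].
exists I, c, (fun i => xget 1 [set x | G x /\ c x = i]).
split=> [i|x Gx]; first by case: xgetP => [x _ []|].
by apply: cP => //; case: xgetP => [y _ []//|/(_ x)]; case.
Qed.

Lemma fin_idx_trans G H K : G 1 -> fin_idx G H -> fin_idx H K -> fin_idx G K.
Proof.
move=> G1 /(fin_idx_reps G1)[I [c [r [Gr cP]]]] [I' [c' cP']].
exists (I * I')%type, (fun x => (c x, c' (x * (r (c x))^-1))) => x y Gx Gy [e].
rewrite e => e'; rewrite -(mulgKA (r (c y))^-1); apply: cP' => //; last exact: cP.
by rewrite -e; exact: cP.
Qed.

Lemma finite_index_fin_idx G K :
  is_subgroup K -> finite_index G K <-> fin_idx G K.
Proof.
move=> sK; split=> [/finite_seqP[s sE]|/[dup] h [I [c cP]]].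
  exists 'I_(size s).+1, (fun x => inord (index (right_coset K x) s)).
  have sP z : G z -> right_coset K z \in s.
    move=> Gz; suff: [set` s] (right_coset K z) by [].
    by rewrite -sE; exists z.
  move=> x y /sP sx /sP sy e.
  have {e} : index (right_coset K x) s = index (right_coset K y) s.
    by have /(congr1 val) := e; rewrite /= !inordK ?ltnS ?index_size.
  move=> /(congr1 (nth set0 s)); rewrite !nth_index// => e.
  have : right_coset K x x by exists 1; rewrite ?mul1g//; exact: is_subgroup1.
  by rewrite e => -[k Kk <-]; rewrite mulgK.
pose r i := xget 1 [set x | G x /\ c x = i].
apply: (@sub_finite_set _ _ ((right_coset K \o r) @` [set: I])); last first.
  by apply: finite_image; exact: finite_finset.
move=> _ [x Gx <-]; exists (c x) => //=; rewrite /r.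
case: xgetP => [y _ [Gy e]|/(_ x)]; last by case.
apply/seteqP; split=> _ [k Kk <-].
  exists (k * (y * x^-1)); last by rewrite -mulgA mulgVK.
  by apply: is_subgroupM => //; apply: cP.
exists (k * (x * y^-1)); last by rewrite -mulgA mulgVK.
by apply: is_subgroupM => //; apply: cP.
Qed.

(** Schreier's lemma: with [T] a finite set of coset representatives, [H] is generated by those
    [u y v^-1] that lie in it, for [u], [v] in [T] and [y] a generator or its inverse, together with
    the elements of [T] in [H]. *)
Lemma fin_idx_generated G H (s : seq gT) : G = generated [set` s] ->
  is_subgroup H -> H `<=` G -> fin_idx G H ->
  exists t : seq gT, H = generated [set` t].
Proof.
move=> GE sH HG; have sG : is_subgroup G by rewrite GE; exact: generated_subgroup.
move=> /(fin_idx_reps (is_subgroup1 sG))[I [c [r [Gr cP]]]].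
pose T := 1 :: [seq r i | i <- enum I].
have TG u : u \in T -> G u.
  by rewrite inE => /predU1P[->|/mapP[i _ ->]//]; exact: is_subgroup1.
have Tr i : r i \in T by rewrite inE map_f ?orbT// mem_enum.
pose U := [seq u * y | u <- T, y <- s ++ map (@monoid.inv gT) s].
pose t := [seq x <- [seq x * v^-1 | x <- U, v <- T] ++ T | `[< H x >]].
exists t; apply/seteqP; split; last first.
  by apply: generated_min => // x; rewrite /= mem_filter => /andP[/asboolP].
(* Reading a word letter by letter keeps it in the form [h * u] with [h] generated by [t]; if the
   word is in [H], then so is the last factor [u]. *)
have H0 : forall x, generated [set` s] x ->
    exists2 h, generated [set` t] h & exists2 u, u \in T & x = h * u.
  apply: generated_ind.
    exists 1; first by apply: is_subgroup1; exact: generated_subgroup.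
    by exists 1; rewrite ?mulg1 ?mem_head.
  have step g y : y \in s ++ map (@monoid.inv gT) s -> (exists2 h, generated [set` t] h &
      exists2 u, u \in T & g = h * u) ->
      exists2 h, generated [set` t] h & exists2 u, u \in T & g * y = h * u.
    move=> sy [h th [u Tu ->]].
    have Gy : G y.
      move: sy; rewrite mem_cat => /orP[sy|/mapP[z sz ->]].
        by rewrite GE; exact: mem_generated.
      by apply: is_subgroupV => //; rewrite GE; exact: mem_generated.
    have Guy : G (u * y) by apply: is_subgroupM => //; exact: TG.
    exists (h * (u * y * (r (c (u * y)))^-1)).
      apply: (is_subgroupM (generated_subgroup _)) => //.
      apply: (@mem_generated _ [set` t]); rewrite /= mem_filter asboolT; last exact: cP.
      by rewrite mem_cat (allpairs_f (fun x v => x * v^-1)) ?Tr// (allpairs_f *%g).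
    by exists (r (c (u * y))) => //; rewrite -!mulgA mulVg mulg1.
  move=> g y hg sy; split; apply: step => //; rewrite mem_cat ?sy//.
  by rewrite (map_f (@monoid.inv gT)) ?orbT.
move=> x Hx; have /HG := Hx; rewrite GE => /H0[h th [u Tu e]].
rewrite e; apply: (is_subgroupM (generated_subgroup _)) => //.
apply: (@mem_generated _ [set` t]); rewrite /= mem_filter mem_cat Tu orbT andbT.
apply/asboolP; apply: (@is_subgroupMl _ _ h) => //; last by rewrite -e.
suff: generated [set` t] `<=` H by apply.
by apply: generated_min => // z; rewrite /= mem_filter => /andP[/asboolP].
Qed.

(** Zorn's lemma. If the union of a chain had finite index, it would be finitely generated by
    Schreier's lemma, so one member of the chain would contain all generators and have finite index
    itself. *)
Lemma weakly_maximal_over G L (s : seq gT) : G = generated [set` s] ->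
  infinite_index_subgroup G L -> exists2 H, weakly_maximal G H & L `<=` H.
Proof.
move=> GE iL.
pose P X := X = set0 \/ infinite_index_subgroup G X /\ L `<=` X.
have [|A [PA Amax]] := @Zorn_bigcup _ P.
  move=> F FP Ftot.
  have [[A FA [a Aa]]|F0] := pselect (exists2 A, F A & A !=set0); last first.
    left; apply/seteqP; split=> // x [A FA Ax].
    by apply: F0; exists A => //; exists x.
  have FI B : F B -> B !=set0 -> infinite_index_subgroup G B /\ L `<=` B.
    by move=> /FP [->|//] [].
  right; have [[sA AG _] LA] := FI _ FA (ex_intro _ a Aa).
  have sU : is_subgroup (\bigcup_(X in F) X).
    apply/is_subgroupP; split=> [|x y [B FB Bx] [C FC Cy]|x [B FB Bx]].
    - by exists A => //; exact: is_subgroup1.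
    - have [[sB _ _] _] := FI _ FB (ex_intro _ x Bx).
      have [[sC _ _] _] := FI _ FC (ex_intro _ y Cy).
      have [BC|CB] := Ftot _ _ FB FC.
        by exists C => //; apply: is_subgroupM => //; exact: BC.
      by exists B => //; apply: is_subgroupM => //; exact: CB.
    - have [[sB _ _] _] := FI _ FB (ex_intro _ x Bx).
      by exists B => //; exact: is_subgroupV.
  have UG : \bigcup_(X in F) X `<=` G.
    by move=> x [B FB Bx]; have [[_ BG _] _] := FI _ FB (ex_intro _ x Bx); exact: BG.
  split; last by move=> x /LA Ax; exists A.
  split=> // /(finite_index_fin_idx _ sU) fU.
  have [t tE] := fin_idx_generated GE sU UG fU.
  have tU x : x \in t -> (\bigcup_(X in F) X) x.
    by move=> tx; rewrite tE; exact: mem_generated.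
  have [B FB tB] : exists2 B, F B & [set` t] `<=` B.
    elim: t {tE} tU => [|x t IHt] tU; first by exists A.
    have [|B FB tB] := IHt; first by move=> y ty; apply: tU; rewrite inE ty orbT.
    have [C FC Cx] := tU x (mem_head _ _).
    have [BC|CB] := Ftot _ _ FB FC.
      by exists C => // y /=; rewrite inE => /predU1P[->|/tB/BC].
    by exists B => // y /=; rewrite inE => /predU1P[->|/tB//]; exact: CB.
  (* If the member found is empty, so is [t]; the union is then trivial, and [A], which contains it,
     would have finite index. *)
  have [B0|B0] := FP _ FB.
    have t0 : t = [::] by case: t tB {tE tU} => // x t /(_ x (mem_head _ _)); rewrite B0.
    have [[sA' _ nfA] _] := FI _ FA (ex_intro _ a Aa).
    apply: nfA; apply/finite_index_fin_idx => //; apply: fin_idxW fU.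
    by rewrite tE; apply: generated_min => // x; rewrite /= t0.
  have [sB _ nfB] := B0.1.
  apply: nfB; apply/finite_index_fin_idx => //; apply: fin_idxW fU.
  by rewrite tE; exact: generated_min.
have [A0|[iA LA]] := PA.
  case: (Amax L); last by right; split.
  have [sL _ _] := iL; split; first by rewrite A0.
  by move/(_ 1 (is_subgroup1 sL)); rewrite A0.
exists A => //; split=> // K iK AK; apply: contrapT => /eqP nKA.
apply: (Amax K); last by right; split=> // x /LA /AK.
by split=> // KA; move/eqP: nKA; apply; apply/seteqP.
Qed.

End FiniteIndex.

Section Hom.
Variables (gT rT : groupType) (G : set gT) (f : gT -> rT).
Hypothesis sG : is_subgroup G.

Definition hom_on := forall x y, G x -> G y -> f (x * y) = f x * f y.

Hypothesis fM : hom_on.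

Lemma hom1 : f 1 = 1.
Proof.
by apply: (mulgI (f 1)); rewrite -fM ?mulg1//; exact: is_subgroup1.
Qed.

Lemma homV x : G x -> f x^-1 = (f x)^-1.
Proof.
move=> Gx; apply: (mulgI (f x)); rewrite -fM// ?mulgV ?hom1//.
exact: is_subgroupV.
Qed.

Lemma homJ x y : G x -> G y -> f (x ^ y) = f x ^ f y.
Proof. by move=> Gx Gy; rewrite /conjg !fM ?homV//; do ?[exact: is_subgroupM|exact: is_subgroupV]. Qed.

Lemma homR x y : G x -> G y -> f [~ x, y] = [~ f x, f y].
Proof.
by move=> Gx Gy; rewrite /commg fM ?homV ?homJ//; do ?[exact: is_subgroupV|exact: is_subgroupJ].
Qed.

Lemma hom_div x y : G x -> G y -> f (x * y^-1) = f x * (f y)^-1.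
Proof. by move=> Gx Gy; rewrite fM ?homV//; exact: is_subgroupV. Qed.

Lemma preimage_subgroup (K : set rT) : is_subgroup K ->
  is_subgroup (G `&` f @^-1` K).
Proof.
move=> sK; apply/is_subgroupP; split=> [|x y [Gx Kx] [Gy Ky]|x [Gx Kx]].
- by split; [exact: is_subgroup1 | rewrite /preimage/= hom1; exact: is_subgroup1].
- by split; [exact: is_subgroupM | rewrite /preimage/= fM//; exact: is_subgroupM].
- by split; [exact: is_subgroupV | rewrite /preimage/= homV//; exact: is_subgroupV].
Qed.

Lemma image_subgroup (K : set gT) : is_subgroup K -> K `<=` G ->
  is_subgroup (f @` K).
Proof.
move=> sK KG; apply/is_subgroupP; split=> [|_ _ [x Kx <-] [y Ky <-]|_ [x Kx <-]].
- by exists 1; [exact: is_subgroup1 | exact: hom1].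
- by exists (x * y); [exact: is_subgroupM | rewrite fM//; exact: KG].
- by exists x^-1; [exact: is_subgroupV | rewrite homV//; exact: KG].
Qed.

Lemma fin_idx_preimage (G' K : set rT) : (forall x, G x -> G' (f x)) ->
  fin_idx G' K -> fin_idx G (G `&` f @^-1` K).
Proof.
move=> fG [I [c cP]]; exists I, (c \o f) => x y Gx Gy /= e.
split; first by apply: is_subgroupM => //; exact: is_subgroupV.
by rewrite /preimage/= hom_div//; apply: cP => //; exact: fG.
Qed.

End Hom.

(** * Automorphism orbits in finitely generated groups *)

Section Countability.
Variable gT : groupType.
Implicit Types (G H : set gT) (s : seq gT).

Lemma fg_words G s : G = generated [set` s] ->
  exists w : seq ('I_(size s) * bool) -> gT, G `<=` range w.
Proof.
move=> ->; pose l (u : 'I_(size s) * bool) :=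
  let x := tnth (in_tuple s) u.1 in if u.2 then x else x^-1.
exists (foldr (fun u x => x * l u) 1); apply: generated_ind; first by exists [::].
move=> _ y [w _ <-] /= /(tnthP (in_tuple s))[i ->].
by split; [exists ((i, true) :: w) | exists ((i, false) :: w)].
Qed.

(** An automorphism is determined on [G] by its values on the generators, and these are words; so
    the orbit is enumerated by lists of words. *)
Lemma countable_aut_orbit G H s : G = generated [set` s] -> H `<=` G ->
  countable (aut_orbit G H).
Proof.
move=> GE HG; have [w wP] := fg_words GE.
(* All automorphisms with the values [map w t] on the generators give [H] the same image, so the
   choice made by [xget] is immaterial. *)
pose F (t : seq (seq ('I_(size s) * bool))) : set gT :=
  xget set0 [set phi @` H | phi in [set phi | is_group_aut G phi /\
    map phi s = map w t]].
suff sub : aut_orbit G H `<=` F @` setT.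
  by apply: (sub_countable (subset_card_le sub)); exact: (sub_countable (card_image_le _ _)).
move=> _ [phi phiG <-].
have phiG' : [set` map phi s] `<=` G.
  move=> _ /mapP[x sx ->]; have [[pG _ _] _] := phiG; apply: pG; rewrite GE.
  exact: mem_generated.
have [t tE] : exists t, map phi s = map w t.
  elim: (map phi s) phiG' => [|x r IHr] rG; first by exists [::].
  have [|t tE] := IHr; first by move=> y ry; apply: rG; rewrite /= inE ry orbT.
  have [u _ ux] := wP x (rG x (mem_head _ _)).
  by exists (u :: t); rewrite /= tE ux.
exists t => //; rewrite /F; case: xgetP => [_ _ [psi [psiG psiE] <-]|/(_ (phi @` H))]; last first.
  by case; exists phi.
have sG : is_subgroup G by rewrite GE; exact: generated_subgroup.
suff e : {in G, psi =1 phi}.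
  by apply: eq_imagel => x /HG Gx; apply: e; exact: mem_set.
have e : [set x | G x /\ psi x = phi x] = G.
  apply/seteqP; split=> [x []//|]; rewrite {1}GE; apply: generated_min.
    apply/is_subgroupP; split=> [|x y [Gx ex] [Gy ey]|x [Gx ex]].
    - by split; [exact: is_subgroup1|rewrite (hom1 sG psiG.2) (hom1 sG phiG.2)].
    - by split; [exact: is_subgroupM|rewrite psiG.2// phiG.2// ex ey].
    - by split; [exact: is_subgroupV|rewrite (homV sG psiG.2)// (homV sG phiG.2)// ex].
  move=> x sx; split; first by rewrite GE; exact: mem_generated.
  by have /eq_in_map e : map psi s = map phi s; [rewrite psiE tE | exact: e].
by move=> x /set_mem; rewrite -{1}e => -[].
Qed.

End Countability.

(* Cosets are represented by distinguished elements, the fixed points of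
   [coset_rep]. *)
Section Quotient.
Variables (gT : groupType) (G N : set gT).
Hypothesis sG : is_subgroup G.
Hypothesis sN : is_subgroup N.
Hypothesis NG : N `<=` G.
Hypothesis nN : forall x y, N x -> G y -> N (x ^ y).

Definition coset_rep (x : gT) : gT := xget 1 [set y | N (x * y^-1)].

Lemma coset_repP x : N (x * (coset_rep x)^-1).
Proof.
rewrite /coset_rep; case: xgetP => // /(_ x) /=.
by rewrite mulgV; case; exact: is_subgroup1.
Qed.

Lemma coset_rep_in x : G x -> G (coset_rep x).
Proof.
move=> Gx; rewrite -[coset_rep x]invgK; apply: is_subgroupV => //.
by apply: (is_subgroupMl sG Gx); apply: NG; exact: coset_repP.
Qed.

Lemma coset_rep_eq x y : N (x * y^-1) <-> coset_rep x = coset_rep y.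
Proof.
split=> [xy|e]; last first.
  rewrite -(mulgKA (coset_rep x)^-1); apply: is_subgroupM => //; first exact: coset_repP.
  by apply: is_subgroupV => //; rewrite e; exact: coset_repP.
rewrite /coset_rep; congr xget; apply/seteqP; split=> z /= h.
  by rewrite -(divgKA x); apply: is_subgroupM => //; rewrite -invgF; apply: is_subgroupV => //; rewrite invgF.
by rewrite -(divgKA y); exact: is_subgroupM.
Qed.


Lemma coset_repK x : coset_rep (coset_rep x) = coset_rep x.
Proof.
apply/esym/coset_rep_eq; exact: coset_repP.
Qed.

Lemma coset_repMl x y : coset_rep (coset_rep x * y) = coset_rep (x * y).
Proof. by apply/esym/coset_rep_eq; rewrite mulgKA; exact: coset_repP. Qed.

Lemma coset_repMr x y : G x -> coset_rep (x * coset_rep y) = coset_rep (x * y).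
Proof.
move=> Gx; apply/esym/coset_rep_eq.
have -> : x * y * (x * coset_rep y)^-1 = (y * (coset_rep y)^-1) ^ x^-1.
  by rewrite /conjg invgK invgM !mulgA.
by apply: nN; [exact: coset_repP | exact: is_subgroupV].
Qed.

Definition coset_type : Type := {x : gT | G x /\ coset_rep x = x}.

HB.instance Definition _ := gen_eqMixin coset_type.
HB.instance Definition _ := gen_choiceMixin coset_type.

Lemma coset_inj (u v : coset_type) : sval u = sval v -> u = v.
Proof.
case: u v => [x hx] [y hy] /= e; rewrite {}e in hx *.
by congr exist; exact: Prop_irrelevance.
Qed.

Lemma coset_proof x : G x -> G (coset_rep x) /\ coset_rep (coset_rep x) = coset_rep x.
Proof. by move=> Gx; split; [exact: coset_rep_in | exact: coset_repK]. Qed.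

Definition coset_one : coset_type := exist _ _ (coset_proof (is_subgroup1 sG)).

Definition coset_mul (u v : coset_type) : coset_type :=
  exist _ _ (coset_proof (is_subgroupM sG (proj1 (svalP u)) (proj1 (svalP v)))).

Definition coset_inv (u : coset_type) : coset_type :=
  exist _ _ (coset_proof (is_subgroupV sG (proj1 (svalP u)))).

Lemma coset_mulA : associative coset_mul.
Proof.
move=> [x [Gx ex]] [y [Gy ey]] [z [Gz ez]]; apply: coset_inj => /=.
by rewrite coset_repMl coset_repMr// mulgA.
Qed.

Lemma coset_mul1 : left_id coset_one coset_mul.
Proof.
by move=> [x [Gx ex]]; apply: coset_inj => /=; rewrite coset_repMl mul1g.
Qed.

Lemma coset_mulr1 : right_id coset_one coset_mul.
Proof.
by move=> [x [Gx ex]]; apply: coset_inj => /=; rewrite coset_repMr// mulg1.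
Qed.

Lemma coset_mulV : left_inverse coset_one coset_inv coset_mul.
Proof.
by move=> [x [Gx ex]]; apply: coset_inj => /=; rewrite coset_repMl mulVg.
Qed.

Lemma coset_mulrV : right_inverse coset_one coset_inv coset_mul.
Proof.
by move=> [x [Gx ex]]; apply: coset_inj => /=; rewrite coset_repMr// mulgV.
Qed.

HB.instance Definition _ := isGroup.Build coset_type
  coset_mulA coset_mul1 coset_mulr1 coset_mulV coset_mulrV.

Lemma quotient_exists : exists (Q : groupType) (pi : gT -> Q),
  [/\ hom_on G pi, forall x, G x -> pi x = 1 <-> N x
    & forall u, exists2 x, G x & pi x = u].
Proof.
have /choice[pi piP] x : exists u : coset_type, G x -> sval u = coset_rep x.
  have [Gx|nGx] := pselect (G x); last by exists 1.
  by exists (exist _ _ (coset_proof Gx) : coset_type).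
exists coset_type, pi; split=> [x y Gx Gy|x Gx|u].
- apply: coset_inj => /=; rewrite !piP//; last exact: is_subgroupM.
  by rewrite coset_repMl coset_repMr.
- split=> [/(congr1 sval)|Nx].
    by rewrite piP// => /coset_rep_eq; rewrite divg1.
  by apply: coset_inj; rewrite piP//; apply/coset_rep_eq; rewrite divg1.
- have [Gu eu] := svalP u; exists (sval u) => //.
  by apply: coset_inj; rewrite piP.
Qed.

End Quotient.

(** * Branch actions *)

Section Trees.
Variable T : rootedTree.
Implicit Types (f g : tree_aut T) (u v w : T).

Lemma tautM f g v : (f * g) v = g (f v).
Proof. by []. Qed.

Lemma tautK f v : f^-1 (f v) = v.
Proof. exact: aut_funK. Qed.

Lemma tautKV f v : f (f^-1 v) = v.
Proof. exact: aut_invK. Qed.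

Lemma taut_inj f : injective f.
Proof. exact: can_inj (aut_funK f). Qed.

Lemma level_taut f v : level (f v) = level v.
Proof.
move: {2}(level v) (erefl (level v)) => n; elim: n v => [|n IHn] v.
  move=> v0; rewrite v0 (proj1 (level_eq0 _) v0) tree_aut_root.
  exact/level_eq0.
move=> lv; have := IHn (parent v); rewrite level_parent lv => /(_ erefl).
rewrite aut_parent level_parent /= => lfn.
suff lf : level (f v) != 0%N by rewrite -(prednK (n := level (f v))) ?lfn// lt0n.
apply/eqP => /(proj1 (level_eq0 _)).
rewrite -[X in _ = X](tree_aut_root f) => /taut_inj vr.
by move: lv; rewrite vr (proj2 (level_eq0 _)).
Qed.

Lemma level_iter n v : level (iter n (@parent T) v) = (level v - n)%N.
Proof.
by elim: n => [|n IHn]; rewrite ?subn0//= level_parent IHn subnS.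
Qed.

Lemma iter_taut n f v : f (iter n (@parent T) v) = iter n (@parent T) (f v).
Proof. by elim: n => //= n IHn; rewrite aut_parent IHn. Qed.

(** The number of steps in [descendants] may exceed the level of [v], the root being its own parent;
    [u] is then the root, which the level difference also reaches. *)
Lemma descendants_level u v : descendants u v ->
  iter (level v - level u) (@parent T) v = u.
Proof.
move=> [n e]; have := level_iter n v; rewrite e => lu.
have [nv|nv] := leqP n (level v); first by rewrite lu subKn.
have u0 : level u = 0%N by rewrite lu; apply/eqP; rewrite subn_eq0 ltnW.
rewrite u0 subn0 (proj1 (level_eq0 u) u0); apply/level_eq0.
by rewrite level_iter subnn.
Qed.

Lemma descendants_refl u : descendants u u.
Proof. by exists 0%N. Qed.

Lemma descendants_trans u v w :
  descendants u v -> descendants v w -> descendants u w.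
Proof. by move=> [n <-] [m <-]; exists (n + m)%N; rewrite iterD. Qed.

Lemma descendants_taut f u v : descendants u v -> descendants (f u) (f v).
Proof. by move=> [n <-]; exists n; rewrite iter_taut. Qed.

Lemma descendants_inj u u' v : level u = level u' ->
  descendants u v -> descendants u' v -> u = u'.
Proof. by move=> l /descendants_level <- /descendants_level <-; rewrite l. Qed.

Lemma level_child u v : children u v -> level v = (level u).+1.
Proof.
move=> [v0 <-]; rewrite level_parent; case: (level v) (level_eq0 v) => //.
by case=> /(_ erefl).
Qed.

Lemma children_descendants u v : children u v -> descendants u v.
Proof. by case=> _ <-; exists 1%N. Qed.

Lemma boundary_level (xi : nat -> T) n : boundary xi -> level (xi n) = n.
Proof.
case=> x0 xS; elim: n => [|n IHn]; first by rewrite x0; exact/level_eq0.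
by rewrite (level_child (xS n)) IHn.
Qed.

Lemma two_children : spherically_homogeneous T -> exists c0 c1 : T -> T,
  forall v, [/\ children v (c0 v), children v (c1 v) & c0 v <> c1 v].
Proof.
move=> [m [m2 cm]].
suff H v : exists c : T * T, [/\ children v c.1, children v c.2 & c.1 <> c.2].
  have [c cP] := choice H.
  by exists (fun v => (c v).1), (fun v => (c v).2).
have /card_leP[f] : (`I_2 #<= children v)%card.
  rewrite (card_le_eqr (cm v)); apply: subset_card_le => k /= /leq_trans; exact.
have i0 : 0%N \in `I_2 by exact: mem_set.
have i1 : 1%N \in `I_2 by exact: mem_set.
pose e0 : `I_2 := exist _ 0%N i0; pose e1 : `I_2 := exist _ 1%N i1.
exists (set_val (f e0), set_val (f e1)).
split; [exact: set_valP|exact: set_valP|] => /= /val_inj.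
by move=> /(@inj _ _ _ f); rewrite !in_setT => /(_ isT isT) [].
Qed.

Hypothesis Tsph : spherically_homogeneous T.

Lemma big_level u N : exists f : nat -> T,
  (forall k, descendants u (f k) /\ level (f k) = (level u + N)%N) /\
  forall k l, k <= N -> l <= N -> f k = f l -> k = l.
Proof.
have [c0 [c1 cP]] := two_children Tsph.
elim: N => [|N [f [fu finj]]].
  exists (fun=> u); split=> [_|[] // []//].
  by split; [exact: descendants_refl | rewrite addn0].
(* One child of each vertex already found, and a second child of the first of them: linear growth is
   enough for the pigeonhole arguments below. *)
exists (fun k => if k is k'.+1 then c0 (f k') else c1 (f 0%N)); split.
  case=> [|k]; have [cc0 cc1 _] := cP (f 0%N).
    have [fu0 lu0] := fu 0%N; split; last by rewrite (level_child cc1) lu0 addnS.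
    exact: descendants_trans fu0 (children_descendants cc1).
  have [fuk luk] := fu k; have [cck _ _] := cP (f k).
  split; last by rewrite (level_child cck) luk addnS.
  exact: descendants_trans fuk (children_descendants cck).
have par k k' : c0 (f k) = c1 (f k') -> f k = f k'.
  have [[_ p0] _ _] := cP (f k); have [_ [_ p1] _] := cP (f k').
  by move=> e; rewrite -p0 -p1 e.
move=> [|k] [|l]; rewrite ?ltnS => kN lN // e.
- have fl := par _ _ (esym e); have [_ _ []] := cP (f 0%N).
  by rewrite -[in LHS]fl -e.
- have fl := par _ _ e; have [_ _ []] := cP (f 0%N).
  by rewrite -[in LHS]fl e.
- congr S; apply: finj => //; have [[_ p0] _ _] := cP (f k).
  by have [[_ p1] _ _] := cP (f l); rewrite -p0 -p1 e.
Qed.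

End Trees.

(** * Rigid stabilisers in a branch action *)

Section Action.
Variables (gT : groupType) (G : set gT) (T : rootedTree).
Variable alpha : gT -> tree_aut T.
Implicit Types (x y z g : gT) (u v w : T) (K : set gT).

(* This form of the finite index condition is preserved by restricting the
   action along an isomorphism of groups. *)
Definition branch_on : Prop :=
  [/\ faithful_action G alpha, level_transitive G alpha &
      forall n M, is_subgroup M -> M `<=` G ->
        (forall u, level u = n -> rigid_stabiliser G alpha u `<=` M) ->
        fin_idx G M].

Lemma branch_action_on : branch_action G alpha -> branch_on.
Proof.
move=> [fG tG iG]; split=> // n M sM MG rM.
have sR := @generated_subgroup _
  (\bigcup_(u in [set u : T | level u = n]) rigid_stabiliser G alpha u).
apply: fin_idxW (proj1 (finite_index_fin_idx _ sR) (iG n)).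
by apply: generated_min => // x [u lu]; exact: rM.
Qed.

Hypothesis sG : is_subgroup G.
Hypothesis fG : faithful_action G alpha.

Let aM : hom_on G alpha := proj1 fG.

Lemma act_inj x y : G x -> G y -> (forall v, alpha x v = alpha y v) -> x = y.
Proof.
move=> Gx Gy xy; apply: divg1_eq; apply: (proj2 fG).
  by apply: is_subgroupM => //; exact: is_subgroupV.
by move=> v; rewrite (hom_div sG)// tautM xy tautK.
Qed.

Lemma actV x v : G x -> alpha x^-1 (alpha x v) = v.
Proof. by move=> Gx; rewrite (homV sG)// tautK. Qed.

Lemma actVK x v : G x -> alpha x (alpha x^-1 v) = v.
Proof. by move=> Gx; rewrite (homV sG)// tautKV. Qed.

Lemma act1 v : alpha 1 v = v.
Proof. by rewrite (hom1 sG). Qed.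

Notation rist := (rigid_stabiliser G alpha).

Lemma rist_sub u : rist u `<=` G.
Proof. by move=> x []. Qed.

Lemma rist_subgroup u : is_subgroup (rist u).
Proof.
apply/is_subgroupP; split=> [|x y [Gx xu] [Gy yu]|x [Gx xu]].
- by split=> [|v _]; [exact: is_subgroup1 | rewrite act1].
- by split=> [|v uv]; [exact: is_subgroupM | rewrite aM// tautM xu ?yu].
- by split=> [|v uv]; [exact: is_subgroupV | rewrite -{1}(xu v)// actV].
Qed.

Lemma rist_conj x g u : rist u x -> G g -> rist (alpha g u) (x ^ g).
Proof.
move=> [Gx xu] Gg; split=> [|v uv]; first exact: is_subgroupJ.
rewrite (homJ sG)// /conjg !tautM xu ?tautKV//.
by move=> /(descendants_taut (alpha g)); rewrite tautKV.
Qed.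

Lemma rist_mono u w : descendants u w -> rist w `<=` rist u.
Proof.
move=> uw x [Gx xw]; split=> // v uv; apply: xw => wv.
exact/uv/(descendants_trans uw).
Qed.

Lemma rist_fix x u : rist u x -> alpha x u = u.
Proof.
move=> [Gx xu]; apply: contrapT => xuu.
apply: (xuu); apply: (@taut_inj _ (alpha x)); apply: xu => du; apply: xuu.
by apply/esym/(descendants_inj _ du (descendants_refl _)); rewrite level_taut.
Qed.

Lemma rist_disjoint x u u' : level u = level u' -> u <> u' ->
  rist u x -> rist u' x -> x = 1.
Proof.
move=> l uu' [Gx xu] [_ xu']; apply: (proj2 fG) => // v.
have [uv|] := pselect (descendants u v); last exact: xu.
by apply: xu' => u'v; apply: uu'; apply: descendants_inj u'v.
Qed.

Lemma rist_commute x y u u' : level u = level u' -> u <> u' ->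
  rist u x -> rist u' y -> commute x y.
Proof.
move=> l uu' ux uy; have [Gx xu] := ux; have [Gy yu] := uy.
have dis v : descendants u v -> ~ descendants u' v.
  by move=> uv u'v; apply: uu'; apply: descendants_inj u'v.
apply: act_inj => [||v]; do ?exact: is_subgroupM.
rewrite !aM// !tautM; have [uv|uv] := pselect (descendants u v).
  rewrite [alpha y v]yu; last exact: dis.
  apply: yu; apply: dis; rewrite -{1}(rist_fix ux).
  exact: descendants_taut.
rewrite (xu v)//; have [u'v|u'v] := pselect (descendants u' v).
  rewrite xu// => du; apply: (dis _ du); rewrite -{1}(rist_fix uy).
  exact: descendants_taut.
by rewrite yu// xu.
Qed.

Lemma rist_moves x u : rist u x -> x <> 1 ->
  exists2 w, descendants u w & alpha x w <> w.
Proof.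
move=> [Gx xu] x1; apply: contrapT => H; apply/x1/(proj2 fG) => // v.
apply: contrapT => xv; apply: H; exists v => //.
by apply: contrapT => /xu.
Qed.

(** If [z] commutes with [x], it equals its conjugate by [x], which is supported below [alpha x w];
    only the identity is supported below two vertices of one level. *)
Lemma moved_commute x z w : G x -> alpha x w <> w -> rist w z ->
  commute x z -> z = 1.
Proof.
move=> Gx xw wz xz; have zx : z ^ x = z by rewrite /conjg -xz mulKg.
apply: (@rist_disjoint _ (alpha x w) w) => //; first by rewrite level_taut.
by rewrite -[z]zx; exact: rist_conj.
Qed.

(* [[x, y] = (y^-1)^x y] and [(y^-1)^x] lives below [alpha x u]. *)
Lemma moved_commg x y z u : G x -> alpha x u <> u -> rist u y -> rist u z ->
  [~ [~ x, y], z] = [~ y, z].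
Proof.
move=> Gx xu uy uz; rewrite (commgEr x); set w := _ ^ x.
have wz : commute w z.
  apply: (@rist_commute _ _ (alpha x u) u) => //; first by rewrite level_taut.
  by apply: rist_conj => //; apply: is_subgroupV => //; exact: rist_subgroup.
have {}wz : z^-1 * w = w * z^-1 by apply/commute_sym/commuteV.
by clearbody w; rewrite /commg /conjg invgM !mulgA -(mulgA _ z^-1 w) wz mulgA mulgVK.
Qed.

Hypothesis tG : level_transitive G alpha.

(** If [K] had finite index, the [G]-orbit of [v n] would have at most [#|I| * #|J|] vertices for
    every [n]; by transitivity it is a whole level, and levels are unboundedly large. *)
Lemma not_fin_idx_orbit K (J : finType) (v : nat -> T) (orb : nat -> J -> T) :
  spherically_homogeneous T ->
  (forall n, n <= level (v n)) ->
  (forall n x, K x -> exists j, alpha x (v n) = orb n j) ->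
  K `<=` G -> ~ fin_idx G K.
Proof.
move=> Tsph lv vP KG /(fin_idx_reps (is_subgroup1 sG))[I [c [r [Gr rP]]]].
set N := #|{: I * J}|; set L := level (v N).
have [f [fL finj]] := big_level Tsph Defs.root L.
have H (k : 'I_N.+1) : exists ij : I * J, f k = alpha (r ij.1) (orb N ij.2).
  have [|x Gx <-] := @tG (v N) (f k).
    by have [_ ->] := fL k; rewrite (proj2 (level_eq0 Defs.root)).
  have [j jE] := vP N _ (rP x Gx); exists (c x, j) => /=.
  by rewrite -jE -tautM -aM ?mulgVK//; exact/KG/rP.
have [h hE] := choice H.
have /leq_card : injective h.
  move=> k l e; apply/ord_inj/finj.
  - by apply: leq_trans (lv N); rewrite -ltnS.
  - by apply: leq_trans (lv N); rewrite -ltnS.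
  - by rewrite !hE e.
by rewrite card_ord ltnn.
Qed.

Hypothesis aG : branch_on.
Hypothesis Tsph : spherically_homogeneous T.

(** If one rigid stabiliser is trivial, then by conjugation so are all those of its level, and the
    branch condition gives the trivial subgroup finite index, which [not_fin_idx_orbit] excludes. *)
Lemma rist_neq1 u : exists2 x, rist u x & x <> 1.
Proof.
apply: contrapT => H; have {}H x : rist u x -> x = 1.
  by move=> ux; apply: contrapT => x1; apply: H; exists x.
have s1 : is_subgroup [set 1 : gT].
  apply/is_subgroupP; split=> // [x y -> ->|x ->]; by rewrite ?mulg1 ?invg1.
have G1 : [set 1] `<=` G by move=> _ ->; exact: is_subgroup1.
have [_ _ /(_ _ _ s1 G1)] := aG; move/(_ (level u)) => f1.
have [f [fL _]] := big_level Tsph Defs.root 0%N.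
pose v n : T := projT1 (cid (big_level Tsph Defs.root n)) 0%N.
apply: (@not_fin_idx_orbit [set 1] unit v (fun n _ => v n)) => //.
- move=> n; rewrite /v; case: cid => h [/= /(_ 0%N) [_ ->] _].
  exact: leq_addl.
- by move=> n _ ->; exists tt; rewrite act1.
apply: f1 => u' lu x u'x; have [g Gg gu] := tG lu.
have := rist_conj u'x Gg; rewrite gu => /H /eqP.
by rewrite conjg_eq1 => /eqP.
Qed.

Variable K : set gT.
Hypothesis sK : is_subgroup K.
Hypothesis KG : K `<=` G.
Hypothesis fK : fin_idx G K.

(** Pigeonhole: of [#|I| + 1] nontrivial elements supported below distinct vertices of one level
    under [u], two have the same colour. Their quotient is in [K], and is nontrivial as the supports
    are disjoint. *)
Lemma fin_idx_rist_neq1 u : exists x, [/\ K x, rist u x & x <> 1].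
Proof.
have [I [c cP]] := fK.
have [f [fL finj]] := big_level Tsph u #|I|.
have [x xP] := choice (fun k => 
  let: ex_intro2 x xu x1 := rist_neq1 (f k) in ex_intro (fun x => rist (f k) x /\ x <> 1) x (conj xu x1)).
have : ~ injective (fun k : 'I_#|I|.+1 => c (x k)).
  by move=> /leq_card; rewrite card_ord ltnn.
move=> ninj; apply: contrapT => H; apply: ninj => k l e.
apply: contrapT => kl; apply: H; exists (x k * (x l)^-1).
have [[xk xk1] [xl xl1]] := (xP k, xP l).
split.
- by apply: cP => //; apply: rist_sub; [exact: xk | exact: xl].
- apply: is_subgroupM; first exact: rist_subgroup.
    by apply: (rist_mono (fL k).1).
  by apply: is_subgroupV; [exact: rist_subgroup | apply: (rist_mono (fL l).1)].
- move/divg1_eq => exl; apply: xk1.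
  apply: (@rist_disjoint _ (f k) (f l)) => //; last by rewrite exl.
    by rewrite (fL k).2 (fL l).2.
  have le (i : 'I_#|I|.+1) : i <= #|I| by rewrite -ltnS.
  by move=> /(finj _ _ (le k) (le l))/ord_inj.
Qed.

Lemma fin_idx_rist_commg u : exists y z,
  [/\ K y /\ rist u y, K z /\ rist u z & [~ y, z] <> 1].
Proof.
have [y [Ky uy y1]] := fin_idx_rist_neq1 u.
have [w uw yw] := rist_moves uy y1.
have [z [Kz wz z1]] := fin_idx_rist_neq1 w.
exists y, z; split=> //; first by split=> //; exact: rist_mono wz.
by move=> /eqP/commgP c; apply: z1; apply: moved_commute yw wz c; exact: KG.
Qed.

(** The part of [K] supported below [u] is not metabelian: a commutator that moves [w] does not
    commute with a nontrivial commutator supported below [w]. *)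
Lemma fin_idx_rist_metabelian u : exists y z y' z',
  [/\ K y /\ rist u y, K z /\ rist u z, K y' /\ rist u y', K z' /\ rist u z' &
     ~ commute [~ y, z] [~ y', z']].
Proof.
have [y [z [[Ky uy] [Kz uz] yz1]]] := fin_idx_rist_commg u.
have su := rist_subgroup u.
have [w uw yzw] := rist_moves (is_subgroupR su uy uz) yz1.
have [y' [z' [[Ky' wy'] [Kz' wz'] yz1']]] := fin_idx_rist_commg w.
exists y, z, y', z'; split=> //; do ?by split=> //; exact: rist_mono uw _ _.
move=> c; apply: yz1'; apply: moved_commute yzw _ c.
  by apply: KG; exact: is_subgroupR.
by apply: is_subgroupR => //; exact: rist_subgroup.
Qed.

End Action.

(** * Two branch actions of one group *)

Section NoFixedEnd.
Variables (gT : groupType) (G : set gT) (T T' : rootedTree).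
Variables (alpha : gT -> tree_aut T) (beta : gT -> tree_aut T').
Hypothesis sG : is_subgroup G.
Hypothesis aG : branch_on G alpha.
Hypothesis bG : branch_on G beta.
Hypothesis T'sph : spherically_homogeneous T'.

Notation rist := (rigid_stabiliser G alpha).
Notation rist' := (rigid_stabiliser G beta).

Let fa : faithful_action G alpha. Proof. by case: aG. Qed.
Let fb : faithful_action G beta. Proof. by case: bG. Qed.
Let tb : level_transitive G beta. Proof. by case: bG. Qed.

Let R : set gT := rigid_level_stabiliser G alpha 1.

Let sR : is_subgroup R. Proof. exact: generated_subgroup. Qed.

Let risR u : level u = 1%N -> rist u `<=` R.
Proof. by move=> lu x ux; apply: mem_generated; exists u. Qed.

Let R_min H : is_subgroup H -> (forall u, level u = 1%N -> rist u `<=` H) ->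
  R `<=` H.
Proof. by move=> sH rH; apply: generated_min => // x [u lu]; exact: rH. Qed.

Let RG : R `<=` G.
Proof. by apply: R_min => // u _; exact: rist_sub. Qed.

Let R_idx : fin_idx G R.
Proof. by case: aG => _ _ /(_ 1%N R sR RG risR). Qed.

Let R_fix u r : level u = 1%N -> R r -> alpha r u = u.
Proof.
move=> lu; pose H := [set g | G g /\ alpha g u = u].
suff RH : R `<=` H by case/RH.
apply: R_min => [|v lv x vx].
  apply/is_subgroupP; split=> [|x y [Gx xu] [Gy yu]|x [Gx xu]].
  - by split; [exact: is_subgroup1 | rewrite (act1 sG fa)].
  - by split; [exact: is_subgroupM | rewrite (proj1 fa)// tautM xu].
  - by split; [exact: is_subgroupV | rewrite -{1}xu (actV sG fa)].
split; first exact: rist_sub vx.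
have [->|uv] := pselect (u = v); first exact: (rist_fix vx).
apply: (proj2 vx) => vu; apply: uv.
by apply: descendants_inj (descendants_refl u) vu; rewrite lu lv.
Qed.

Let R_conj r g : G g -> R r -> R (r ^ g).
Proof.
move=> Gg; pose H := [set x | R (x ^ g)].
suff RH : R `<=` H by move/RH.
apply: R_min => [|v lv x vx].
  apply/is_subgroupP; split=> [|x y Rx Ry|x Rx]; rewrite /H/=.
  - by rewrite conj1g; exact: (is_subgroup1 sR).
  - by rewrite conjMg; exact: (is_subgroupM sR).
  - by rewrite conjVg; exact: (is_subgroupV sR).
apply: (risR (u := alpha g v)); first by rewrite level_taut.
exact: (rist_conj sG fa).
Qed.

Let swallows u v := forall y z, R y -> R z -> rist' v y -> rist' v z ->
  rist u [~ y, z].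

(** As [R] normalises [rist u], the commutator [[[x, y], z]] is in [rist u]; by [moved_commg] it
    equals [[y, z]]. *)
Let moved_swallows u v x : level u = 1%N -> rist u x -> beta x v <> v ->
  swallows u v.
Proof.
move=> lu ux xv y z Ry Rz vy vz.
have nu r t : R r -> rist u t -> rist u (t ^ r).
  move=> Rr ut; rewrite -(R_fix lu Rr); apply: (rist_conj sG fa) => //.
  exact: RG.
have su := rist_subgroup sG fa u.
have uxy : rist u [~ x, y] by apply: (is_subgroupM su (is_subgroupV su ux)); exact: nu.
rewrite -(moved_commg sG fb (proj1 ux) xv vy vz).
by apply: (is_subgroupM su (is_subgroupV su uxy)); exact: nu.
Qed.

(** Rigid stabilisers of distinct first-level vertices commute, while the part of [R] below [v] is
    not metabelian. *)
Let swallows_disjoint u u' v : level u = 1%N -> level u' = 1%N -> u <> u' ->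
  swallows u v -> swallows u' v -> False.
Proof.
move=> lu lu' uu' su su'.
have [y [z [y' [z' [[Ry vy] [Rz vz] [Ry' vy'] [Rz' vz'] c]]]]] :=
  fin_idx_rist_metabelian sG fb tb bG T'sph sR RG R_idx v.
apply/c/(rist_commute sG fa _ uu'); [by rewrite lu lu'|exact: su|exact: su'].
Qed.

Let swallows_act g u v : G g -> beta g v = v -> swallows u v ->
  swallows (alpha g u) v.
Proof.
move=> Gg gv su y z Ry Rz vy vz.
have Gg' : G g^-1 by exact: is_subgroupV.
have g'v : beta g^-1 v = v by rewrite -{1}gv (actV sG fb).
rewrite -[y](conjgKV g) -[z](conjgKV g) -conjRg.
apply: (rist_conj sG fa) => //; apply: su; do ?exact: R_conj.
  by rewrite -{1}g'v; apply: (rist_conj sG fb).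
by rewrite -{1}g'v; apply: (rist_conj sG fb).
Qed.

(* Along the end, either some first-level rigid stabiliser of [T] contains the
   commutators of a deep rigid stabiliser of [T'], and then it is unique, hence
   [a]-invariant; or the end is fixed by the finite index subgroup [R]. *)
Lemma no_fixed_end a xi : G a -> (forall u : T, level u = 1%N -> alpha a u <> u) ->
  boundary xi -> ~ parabolic G beta xi a.
Proof.
move=> Ga amv bxi [_ axi].
have [[n [u [lu su]]]|nsw] := pselect (exists n u, level u = 1%N /\ swallows u (xi n)).
  apply: (swallows_disjoint _ lu (amv _ lu) _ su); first by rewrite level_taut.
  exact: swallows_act.
pose P := parabolic G beta xi.
have sP : is_subgroup P.
  apply/is_subgroupP; split=> [|x y [Gx xx] [Gy yx]|x [Gx xx]].
  - by split=> [|n]; [exact: is_subgroup1 | rewrite (act1 sG fb)].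
  - by split=> [|n]; [exact: is_subgroupM | rewrite (proj1 fb)// tautM xx].
  - by split=> [|n]; [exact: is_subgroupV | rewrite -{1}(xx n) (actV sG fb)].
have PG : P `<=` G by move=> x [].
apply: (not_fin_idx_orbit sG fb tb (J := unit) (v := xi) (orb := fun n _ => xi n)
  T'sph _ _ PG) => [n|n x [_ xx]|].
- by rewrite boundary_level.
- by exists tt.
case: aG => _ _ /(_ 1%N); apply=> // u lu x ux.
split=> [|n]; first exact: rist_sub ux.
apply: contrapT => xn; apply: nsw; exists n, u; split=> //.
exact: moved_swallows xn.
Qed.

End NoFixedEnd.

(** * Weakly maximal subgroups from sets of ends *)

(** Serves for the conjugation that carries [G] to a group in standard form, and for automorphisms
    of [G] when orbits are compared. *)
Lemma branch_on_comp (gT1 gT2 : groupType) (G1 : set gT1) (G2 : set gT2)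
    (T : rootedTree) (alpha : gT2 -> tree_aut T) (phi : gT1 -> gT2) :
  is_subgroup G1 -> set_bij G1 G2 phi -> hom_on G1 phi ->
  branch_on G2 alpha -> branch_on G1 (alpha \o phi).
Proof.
move=> sG1 [phiG phiI phiS] phiM [[aM a1] aT aI]; split.
- split=> [x y Gx Gy|x Gx x1] /=; first by rewrite phiM// aM//; exact: phiG.
  have p1 : phi x = 1 by apply: (a1 _ (phiG _ Gx)).
  by apply: phiI; [exact: mem_set|apply: mem_set; exact: is_subgroup1|rewrite (hom1 sG1 phiM)].
- move=> u v /aT[y /phiS[x Gx <-] xu]; by exists x.
- move=> n M sM MG rM.
  have pMG : phi @` M `<=` G2 by move=> _ [x /MG Gx <-]; exact: phiG.
  have f2 : fin_idx G2 (phi @` M).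
    apply: (aI n _ (image_subgroup sG1 phiM sM MG) pMG).
    by move=> u lu _ [/phiS[x Gx <-] xu]; exists x => //; apply: (rM u lu).
  apply: fin_idxW (fin_idx_preimage sG1 phiM phiG f2) => x [Gx [y My e]].
  by rewrite -(phiI y x) ?inE//; exact: MG.
Qed.

Section RegularTreeFacts.
Variable p : nat.

Lemma iter_word_parent n (v : regular_tree p) :
  iter n (@parent (regular_tree p)) v = take (size v - n) v.
Proof.
elim: n => [|n IHn]; first by rewrite subn0 take_size.
rewrite iterS IHn /= /word_parent take_takel ?size_takel ?leq_subr//.
  by rewrite -subnS.
by rewrite leq_pred.
Qed.

Lemma word_descendants (u v : regular_tree p) :
  descendants u v -> take (size u) v = u.
Proof.
move=> [n]; rewrite iter_word_parent => <-.
by rewrite size_takel ?leq_subr.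
Qed.

Lemma regular_tree_sph : 1 < p -> spherically_homogeneous (regular_tree p).
Proof.
move=> p1; exists (fun=> p); split=> // u.
have -> : children u = (rcons (u : seq 'I_p) : 'I_p -> regular_tree p) @` setT.
  apply/seteqP; split=> [v [v0 <-]|_ [x _ <-]].
    case/lastP: v v0 => [[]//|v x _]; exists x => //.
    by rewrite /= word_parent_rcons.
  split; last exact: word_parent_rcons.
  by move/(congr1 size); rewrite size_rcons.
apply: card_eq_trans (card_esym card_II).
by apply: inj_card_eq => x y _ _ /rcons_inj[].
Qed.

End RegularTreeFacts.

Lemma cantor (g : (nat -> bool) -> nat) : ~ injective g.
Proof.
move=> ginj; pose D n := ~~ `[< exists2 f, g f = n & f n >].
have : D (g D) <-> ~ D (g D).
  split; first by move=> /asboolPn DgD h; apply: DgD; exists D.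
  move=> nD; apply/asboolPn => -[f /ginj fD]; by rewrite fD.
by case: (D _) => -[]; [move=> /(_ isT)|move=> _ /(_ notF)].
Qed.

Lemma aut_orbit_refl (gT : groupType) (G H : set gT) : aut_orbit G H H.
Proof.
exists id; last by rewrite image_id.
by split=> //; split=> // x Gx; exists x.
Qed.

Section WeaklyMaximal.
Variables (gT : groupType) (G : set gT) (s : seq gT) (p : nat).
Variable alpha : gT -> tree_aut (regular_tree p).
Hypothesis p1 : 1 < p.
Hypothesis GE : G = generated [set` s].
Hypothesis aG : branch_on G alpha.
Variable a : gT.
Hypothesis Ga : G a.
Hypothesis aE : alpha a = rooted_a p.

Let sG : is_subgroup G. Proof. rewrite GE; exact: generated_subgroup. Qed.
Let fa : faithful_action G alpha. Proof. by case: aG. Qed.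

Implicit Types w : nat -> 'I_p.

(* The stabiliser of the set of [p] ends [i w_0 w_1 w_2 ...], [i < p]. *)
Definition end_set_stabiliser w : set gT :=
  [set x | G x /\ forall n i, exists j : 'I_p,
    alpha x (i :: mkseq w n) = j :: mkseq w n].

Lemma end_set_stabiliser_subgroup w : is_subgroup (end_set_stabiliser w).
Proof.
apply/is_subgroupP; split=> [|x y [Gx xw] [Gy yw]|x [Gx xw]].
- by split=> [|n i]; [exact: is_subgroup1 | exists i; rewrite (act1 sG fa)].
- split=> [|n i]; first exact: is_subgroupM.
  have [j xj] := xw n i; have [k yk] := yw n j; exists k.
  by rewrite (proj1 fa)// tautM xj yk.
- split=> [|n i]; first exact: is_subgroupV.
  have [t tE] := choice (xw n).
  have tinj : injective t.
    move=> j k e; have : alpha x (j :: mkseq w n) = alpha x (k :: mkseq w n).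
      by rewrite !tE e.
    by move/taut_inj => [].
  exists (invF tinj i); apply: (@taut_inj _ (alpha x)).
  by rewrite (actVK sG fa)// tE f_invF.
Qed.

Lemma end_set_stabiliser_infinite_index w :
  infinite_index_subgroup G (end_set_stabiliser w).
Proof.
have sL := end_set_stabiliser_subgroup w.
have LG : end_set_stabiliser w `<=` G by move=> x [].
split=> // /(finite_index_fin_idx _ sL).
have [_ ta _] := aG; have i0 : 'I_p := Ordinal (ltnW p1).
apply: (not_fin_idx_orbit sG fa ta (v := fun n => i0 :: mkseq w n)
  (orb := fun n j => j :: mkseq w n)) => //.
- exact: regular_tree_sph.
- by move=> n; rewrite /= size_mkseq.
- by move=> n x [_ /(_ n i0)].
Qed.

Lemma end_set_stabiliser_rooted w : end_set_stabiliser w a.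
Proof. by split=> // n i; exists (ordS i); rewrite aE. Qed.

(** If [u] is not a prefix of [w], no vertex of the [p] ends lies below [i :: u], so all of them are
    fixed. *)
Lemma rist_end_set_stabiliser w i (u : seq 'I_p) : u <> mkseq w (size u) ->
  rigid_stabiliser G alpha (i :: u) `<=` end_set_stabiliser w.
Proof.
move=> uw x [Gx xu]; split=> // n j; exists j; apply: xu => /word_descendants.
move=> [_ ue]; apply: uw; rewrite -[LHS]ue.
have nu : size u <= n.
  by move/(congr1 size): ue; rewrite size_take_min size_mkseq => /minn_idPl.
by rewrite /mkseq -map_take take_iota (minn_idPl nu).
Qed.

Lemma weakly_maximal_end_sets_eq H w w' : weakly_maximal G H ->
  end_set_stabiliser w `<=` H -> end_set_stabiliser w' `<=` H -> w = w'.
Proof.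
move=> [[sH HG nH] _] wH w'H; apply: funext => k; apply: contrapT => kw.
apply: nH; apply/finite_index_fin_idx => //.
(* A vertex of level [k + 2] has [k + 1] letters after the first; these include the index [k], where
   [w] and [w'] differ, so they are not a prefix of both. *)
have [_ _ /(_ k.+2 H sH HG)] := aG; apply=> -[|i u] //= [su].
have [uw|uw] := pselect (u = mkseq w (size u)); last first.
  exact: subset_trans (rist_end_set_stabiliser uw) wH.
have uw' : u <> mkseq w' (size u).
  rewrite {1}uw su => /(congr1 (fun r => nth (w 0%N) r k)).
  by rewrite !nth_mkseq.
exact: subset_trans (rist_end_set_stabiliser uw') w'H.
Qed.

Theorem uncountable_weakly_maximal_orbits :
  ~ countable [set O : set (set gT) |
      (exists2 H, weakly_maximal G H & O = aut_orbit G H) /\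
      forall (T' : rootedTree) (beta : gT -> tree_aut T') (xi : nat -> T'),
        spherically_homogeneous T' -> branch_action G beta -> boundary xi ->
        O <> aut_orbit G (parabolic G beta xi)].
Proof.
set Os := [set O | _] => cOs.
have /choice[H HP] w : exists H, weakly_maximal G H /\ end_set_stabiliser w `<=` H.
  have [H] := weakly_maximal_over GE (end_set_stabiliser_infinite_index w).
  by exists H.
pose l (f : nat -> bool) n : 'I_p := if f n then Ordinal p1 else Ordinal (ltnW p1).
have linj : injective l.
  move=> f g e; apply: funext => n; have := congr1 (fun h => h n) e.
  by rewrite /l; case: (f n) (g n) => -[] //.
have Hinj : injective (H \o l).
  move=> f g /= e; apply/linj/(weakly_maximal_end_sets_eq (HP (l f)).1).
    exact: (HP (l f)).2.
  by rewrite e; exact: (HP (l g)).2.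
have HO w : Os (aut_orbit G (H w)).
  split; first by exists (H w) => //; exact: (HP w).1.
  move=> T' beta xi T'sph /branch_action_on bG bxi e.
  (* An automorphism [phi] carries the parabolic to [H w]. The element [b] that it sends to [a]
     fixes an end, although it acts as [a] in the branch action [alpha \o phi]. *)
  have := @aut_orbit_refl _ G (H w); rewrite e => -[phi [phiB phiM] phiE].
  have : H w a by apply: (HP w).2; exact: end_set_stabiliser_rooted.
  rewrite -phiE => -[b bP be].
  apply: (no_fixed_end sG (branch_on_comp sG phiB phiM aG) bG T'sph _ _ bxi bP).
    by case: bP.
  move=> [|i [|]]//= _; rewrite be aE /= => -[].
  move=> /(congr1 val)/= ii.
  case: (ltngtP i.+1 p) (ltn_ord i) => // ip _.
    by move: ii; rewrite modn_small// => /esym/n_Sn.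
  have : i.+1 %% i.+1 = i by rewrite -[RHS]ii ip.
  by rewrite modnn => i0; move: p1; rewrite -ip -[in X in _ < X]i0.
(* Countably many countable orbits would contain all the [H (l f)], and binary sequences would
   inject into [nat]. *)
have cU : countable (\bigcup_(O in Os) O).
  apply: bigcup_countable => // O [[K [[_ KG _] _] ->] _].
  exact: countable_aut_orbit GE KG.
have [h hinj] := countable_injP _ cU.
have HU f : (\bigcup_(O in Os) O) (H (l f)).
  by exists (aut_orbit G (H (l f))) => //; exact: aut_orbit_refl.
apply: (@cantor (h \o (H \o l))) => f g /= e; apply: Hinj => /=.
by apply: hinj e; exact: mem_set.
Qed.

End WeaklyMaximal.

(** * Finiteness of the quotient by the branching subgroup *)

Section ClassTwo.
Variables (Q : groupType) (I : finType) (p : nat) (a : Q) (b : I -> Q).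
Hypothesis p0 : 0 < p.
Hypothesis ap : a ^+ p = 1.
Hypothesis bp : forall i, b i ^+ p = 1.
Hypothesis bC : forall i j, commute (b i) (b j).
Hypothesis baa : forall i, commute [~ b i, a] a.
Hypothesis bab : forall i j, commute [~ b i, a] (b j).

Let mon (v : I -> nat) : Q := \prod_i b i ^+ v i.

Let monM v v' : mon v * mon v' = mon (fun i => v i + v' i)%N.
Proof.
rewrite /mon -prodgM_commute; last first.
  by move=> i j _ _; apply: commuteX2.
by apply: eq_bigr => i _; rewrite expgnDr.
Qed.

Let mon1 : mon (fun=> 0%N) = 1.
Proof. by rewrite /mon big1. Qed.

Let monb i : mon (fun j => j == i) = b i.
Proof.
rewrite /mon (eq_bigr (fun j => if j == i then b j else 1)).
  by rewrite -big_mkcond /= big_pred1_eq.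
by move=> j _; rewrite expgb.
Qed.

Let mon_ind (P : Q -> Prop) : P 1 -> (forall x i, P x -> P (x * b i)) ->
  forall v, P (mon v).
Proof.
move=> P1 PM v; rewrite /mon.
suff H r x : P x -> P (x * \prod_(i <- r) b i ^+ v i) by rewrite -[X in P X]mul1g; exact: H.
elim: r x => [|i r IHr] x Px; first by rewrite big_nil mulg1.
rewrite big_cons mulgA; apply: IHr; elim: (v i) => [|n IHn]; first by rewrite mulg1.
by rewrite expgSr mulgA; exact: PM.
Qed.

Let mon_commute x v : (forall i, commute x (b i)) -> commute x (mon v).
Proof. by move=> xb; apply: commute_prod => i _; exact: commuteX. Qed.

(** By [[x y, a] = [x, a]^y [y, a]], centrality passes from the [[b i, a]] to commutators of
    monomials. *)
Let commg_central v : commute [~ mon v, a] a /\ forall i, commute [~ mon v, a] (b i).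
Proof.
move: v; apply: (mon_ind (P := fun x => commute [~ x, a] a /\ forall i, commute [~ x, a] (b i))).
  by rewrite comm1g; split=> [|i]; apply/commute_sym/commute1.
move=> x i [xa xb].
have -> : [~ x * b i, a] = [~ x, a] * [~ b i, a].
  have /conjg_fixP e : [~ [~ x, a], b i] == 1 by apply/commgP.
  by rewrite -[in RHS]e /commg /conjg !invgM !mulgA !mulgK.
split=> [|j]; apply/commute_sym/commuteM; apply/commute_sym => //.
Qed.

Let commg_mon v w : [~ mon v, a] * [~ mon w, a] = [~ mon v * mon w, a].
Proof.
have [_ vb] := commg_central v.
have /conjg_fixP e : [~ [~ mon v, a], mon w] == 1.
  by apply/commgP; exact: mon_commute.
by rewrite -[in LHS]e /commg /conjg !invgM !mulgA !mulgK.
Qed.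

(** Normal form in a group of class at most two. Moving [a] to the left past [mon v] creates
    [[mon v, a]], which the last factor absorbs. *)
Let Y : set Q := [set q | exists n v w, q = a ^+ n * mon v * [~ mon w, a]].

Let Y1 : Y 1.
Proof.
by exists 0%N, (fun=> 0%N), (fun=> 0%N); rewrite mon1 comm1g expg0 !mulg1.
Qed.

Let Ya q : Y q -> Y (q * a).
Proof.
move=> [n [v [w ->]]]; exists n.+1, v, (fun i => v i + w i)%N.
have [va vb] := commg_central v; have [wa wb] := commg_central w.
rewrite -mulgA wa mulgA -(mulgA _ (mon v) a) (commgC (mon v) a) -monM -commg_mon.
by rewrite expgSr !mulgA.
Qed.

Let Yb q i : Y q -> Y (q * b i).
Proof.
move=> [n [v [w ->]]]; exists n, (fun j => v j + (j == i))%N, w.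
have [wa wb] := commg_central w.
by rewrite -mulgA wb mulgA -(mulgA _ (mon v)) -monb monM.
Qed.

Let YV (x : Q) : x ^+ p = 1 -> (forall q, Y q -> Y (q * x)) ->
  forall q, Y q -> Y (q * x) /\ Y (q * x^-1).
Proof.
move=> xp Yx q Yq; split; first exact: Yx.
have -> : x^-1 = x ^+ p.-1.
  by apply: (mulgI x); rewrite mulgV -expgS prednK.
elim: p.-1 => [|n IHn]; first by rewrite expg0 mulg1.
by rewrite expgSr mulgA; exact: Yx.
Qed.

Let expg_mod_order (x : Q) n : x ^+ p = 1 -> x ^+ n = x ^+ (n %% p).
Proof.
by move=> xp; rewrite {1}(divn_eq n p) expgnDr mulnC expgnA xp expg1n mul1g.
Qed.

(** The normal forms are stable under right multiplication by the generators and their inverses, and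
    their exponents matter only modulo [p]. *)
Lemma class_two_finite : exists (J : finType) (F : J -> Q),
  generated ([set a] `|` range b) `<=` range F.
Proof.
pose e (f : {ffun I -> 'I_p}) i : nat := f i.
exists ('I_p * {ffun I -> 'I_p} * {ffun I -> 'I_p})%type.
exists (fun j : 'I_p * {ffun I -> 'I_p} * {ffun I -> 'I_p} => a ^+ (j.1.1 : nat) * mon (e j.1.2) * [~ mon (e j.2), a]) => q gq.
have /(_ q gq 1 Y1) [] : generated ([set a] `|` range b) `<=`
    [set x | forall q, Y q -> Y (q * x) /\ Y (q * x^-1)].
  apply: generated_min => [|_ [->|[i _ <-]]].
  - apply/is_subgroupP; split=> [r Yr|x y Yx Yy r Yr|x Yx r Yr].
    + by rewrite invg1 mulg1.
    + rewrite invgM !mulgA; split; first exact: (Yy _ (Yx _ Yr).1).1.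
      exact: (Yx _ (Yy _ Yr).2).2.
    + by rewrite invgK; have [] := Yx _ Yr.
  - exact: YV.
  - by apply: YV => // r; exact: Yb.
rewrite mul1g => -[n [v [w ->]]] _.
have me (u : I -> nat) : exists f, mon u = mon (e f).
  exists [ffun i => Ordinal (ltn_pmod (u i) p0)]; apply: eq_bigr => i _.
  by rewrite /e ffunE /= -expg_mod_order.
have [[f ->] [g ->]] := (me v, me w).
exists (Ordinal (ltn_pmod n p0), f, g) => //=.
by rewrite -expg_mod_order.
Qed.

End ClassTwo.

(* The relation [(x, 1, x^(a^-1))] of the Gupta-Sidki 3-group gives
   [x^(a^-1) = x^-1] for [x = [b, a]]. *)
Lemma inverted_commutator (Q : groupType) (a b : Q) : a ^+ 3 = 1 -> 
  [~ b, a] ^ a^-1 = [~ b, a]^-1 -> commute b a.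
Proof.
set x := [~ b, a] => a3 xa.
(* Conjugating three times by [a^-1] is trivial and inverts [x] three times. *)
have xx : x = x^-1.
  have a3' : a^-1 * a^-1 * a^-1 = 1 by apply: invg_inj; rewrite !invgM !invgK invg1 -a3.
  rewrite -{1}[x]conjg1 -a3' !conjgM xa conjVg xa invgK.
  by rewrite xa.
have bx : b ^ a = b * x by rewrite /x /commg mulVKg.
have xE : [~ b, a] = x by [].
clearbody x.
have xa' : x ^ a = x by rewrite {1}xx -xa conjgKV.
(* As [x] commutes with [a], each conjugation by [a] multiplies [b] by [x], and [x^3 = x]. *)
have b3 : b ^ (a ^+ 3) = b * x.
  rewrite !expgS expg0 mulg1 !conjgM bx conjMg bx xa' !conjMg bx xa'.
  by rewrite -!mulgA {2}xx mulVg mulg1.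
move: b3; rewrite a3 conjg1 -[LHS]mulg1 => /mulgI /esym x1.
by apply/commgP/eqP; rewrite xE.
Qed.

(** * Exponent vectors as functions on the nonzero residues *)

Section Profile.
Variable p : nat.
Hypothesis p_pr : prime p.
Hypothesis p_odd : odd p.
Import GRing.Theory.
Local Open Scope ring_scope.

Let charFp := pchar_Fp p_pr.

Let natFp_neq0 n : (0 < n)%N -> (n < p)%N -> n%:R != 0 :> 'F_p.
Proof.
by move=> n0 np; rewrite -(dvdn_pcharf charFp) gtnNdvd.
Qed.

Let natFp (x : 'F_p) : exists2 n, (n < p)%N & x = n%:R.
Proof.
exists (val x); last by rewrite natr_Zp.
by apply: leq_trans (ltn_ord x) _; rewrite Fp_cast.
Qed.

Lemma Fp_double_neq0 (d : 'F_p) : d != 0 -> d + d != 0.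
Proof.
move=> d0; rewrite -mulr2n -mulr_natr mulf_neq0// natFp_neq0//.
by rewrite ltn_neqAle prime_gt1// andbT; apply: contraTneq p_odd => <-.
Qed.

(* If [e (k - d) / e k] does not depend on [k], then [e] is geometric along the
   multiples of [d]. *)
Lemma geometric_profile (e : 'F_p -> 'F_p) d : d != 0 -> e (- d) != 0 ->
  (forall k k', k != 0 -> k != d -> k' != 0 -> k' != d ->
     e k * e (k' - d) = e k' * e (k - d)) ->
  exists l, forall n, (n.+1 < p)%N -> e (- (n.+1%:R * d)) = l ^+ n * e (- d).
Proof.
move=> d0 ed0 H; exists (e (- d - d) / e (- d)); elim=> [|n IHn] np.
  by rewrite mul1r expr0 mul1r.
have step k : k != 0 -> k != d -> e (k - d) = e (- d - d) / e (- d) * e k.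
  move=> k0 kd; have := H k (- d) k0 kd; rewrite oppr_eq0 => /(_ d0).
  rewrite eq_sym -subr_eq0 opprK => /(_ (Fp_double_neq0 d0)) E.
  by apply: (mulfI ed0); rewrite -E; field.
have -> : - (n.+2%:R * d) = - (n.+1%:R * d) - d by rewrite -natr1; ring.
rewrite step ?IHn ?(ltnW np)//; first by rewrite exprS mulrA.
  by rewrite oppr_eq0 mulf_neq0// natFp_neq0// ltnW.
rewrite eq_sym -subr_eq0 opprK -[X in X + _]mul1r -mulrDl mulf_neq0//.
by rewrite addrC natr1 natFp_neq0.
Qed.

(** Outside the first two cases [e] is geometric with a ratio [l], which is not 0 because [e d] is
    not, and not 1 because [e] is not constant. For [p > 3] the relation with step [2d] forces
    [l^p = 1], so [l = 1] by Fermat; for [p = 3] only [l = -1] remains. *)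
Lemma nonconstant_profile (e : 'F_p -> 'F_p) k1 k2 :
  k1 != 0 -> k2 != 0 -> e k1 != e k2 ->
  [\/ exists d, [/\ d != 0, e d != 0 & e (- d) = 0],
      exists d k k', [/\ d != 0, e d != 0, e (- d) != 0,
        [/\ k != 0, k != d, k' != 0 & k' != d] &
        e k * e (k' - d) != e k' * e (k - d)]
    | p = 3 /\ forall d, d != 0 -> e d != 0 /\ e (- d) = - e d].
Proof.
move=> k10 k20 ek.
have [C1|nC1] := pselect (exists d, [/\ d != 0, e d != 0 & e (- d) = 0]).
  by constructor 1.
set P2 := exists d k k', _; have [C2|nC2] := pselect P2; first by constructor 2.
constructor 3.
have [d d0 ed0] : exists2 d, d != 0 & e d != 0.
  have [e1|e1] := eqVneq (e k1) 0; last by exists k1.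
  by exists k2 => //; rewrite -e1 eq_sym.
have neg x : x != 0 -> e x != 0 -> e (- x) != 0.
  by move=> x0 ex0; apply/eqP => ex; apply: nC1; exists x.
have sym x : x != 0 -> e x != 0 -> forall k k', k != 0 -> k != x -> k' != 0 ->
    k' != x -> e k * e (k' - x) = e k' * e (k - x).
  move=> x0 ex0 k k' *; apply/eqP/negPn/negP => h; apply: nC2.
  by exists x, k, k'; split=> //; exact: neg.
have [l lP] := geometric_profile d0 (neg _ d0 ed0) (sym _ d0 ed0).
have p2 : (2 < p)%N.
  by rewrite ltn_neqAle prime_gt1// andbT; apply: contraTneq p_odd => <-.
(* [-d] generates the additive group, so the geometric formula covers every nonzero residue. *)
have allP x : x != 0 -> exists2 n, (n.+1 < p)%N & x = - (n.+1%:R * d).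
  move=> x0; have [[|n] np xE] := natFp (x / - d).
    by move/eqP: xE; rewrite mulf_eq0 invr_eq0 oppr_eq0 (negPf x0) (negPf d0).
  by exists n => //; rewrite -xE invrN mulrN mulNr opprK divfK.
have l0 : l != 0.
  have [n np dE] := allP d d0; have := lP n np; rewrite -dE.
  case: n np dE => [|n] np dE.
    move=> _; have := Fp_double_neq0 d0.
    by rewrite {1}dE mul1r addNr eqxx.
  move=> eE; apply: contra_neqN ed0 => /eqP l0.
  by rewrite eE l0 exprS !mul0r.
have edN := neg _ d0 ed0.
have e0 x : x != 0 -> e x != 0.
  by move=> /allP[n np ->]; rewrite lP// mulf_neq0// expf_neq0.
have l1 : l != 1.
  apply: contraNneq ek => l1.
  have ec x : x != 0 -> e x = e (- d).
    by move=> /allP[n np ->]; rewrite lP// l1 expr1n mul1r.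
  by rewrite !ec.
have [q pq] : exists q, p = q.+3 by exists (p - 3)%N; rewrite -addn3 subnK.
have lN : e d = l ^+ q.+1 * e (- d).
  rewrite -lP ?pq//; congr e; apply/eqP.
  rewrite -addr_eq0 -[X in X + _]mul1r -mulrDl addrC natr1 -pq.
  by rewrite (pcharf0 charFp) mul0r.
case: q pq lN => [|q] pq lN.
  have lE : l = -1.
    have [n np lE] := natFp l; have n2 : n = 2%N.
      move: l0 l1; rewrite lE; rewrite [X in (_ < X)%N]pq in np; move: np {lE}.
      by case: n => [|[|[|]]]//; rewrite eqxx.
    apply/eqP; rewrite lE n2 -addr_eq0 natr1.
    by rewrite -(dvdn_pcharf charFp) [X in (X %| _)%N]pq.
  move: lN; rewrite expr1 lE mulN1r => lN.
  split=> // x x0; split; first exact: e0.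
  have [[|[|n]] np xE] := allP x x0; last by rewrite [X in (_ < X)%N]pq in np.
    by rewrite xE mul1r opprK.
  have -> : x = d.
    rewrite xE; apply/eqP; rewrite -subr_eq0 -opprD oppr_eq0 -[X in _ + X]mul1r -mulrDl.
    by rewrite natr1 mulf_eq0 -(dvdn_pcharf charFp) [X in (X %| _)%N]pq.
  by rewrite lN opprK.
have d2 := Fp_double_neq0 d0.
have p5 : (3 < p)%N by rewrite pq.
have dd : - d != d + d.
  rewrite eq_sym -subr_eq0 opprK.
  have -> : d + d + d = 3%:R * d by ring.
  by rewrite mulf_neq0// natFp_neq0.
have d2d : d != d + d by rewrite -subr_eq0 opprD addrA subrr sub0r oppr_eq0.
(* This reads [e(-d)^2 = e(d) e(-3d)], where [e(d) = l^(p-2) e(-d)] and [e(-3d) = l^2 e(-d)]. *)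
have := sym _ d2 (e0 _ d2) (- d) d.
rewrite oppr_eq0 => /(_ d0 dd d0 d2d).
have -> : d - (d + d) = - d by ring.
have -> : - d - (d + d) = - (3%:R * d) by ring.
rewrite lP// lN => E; case/eqP: l1; rewrite -[LHS]expf_card card_Fp//.
have : (e (- d) * e (- d)) * 1 = (e (- d) * e (- d)) * l ^+ p.
  have -> : l ^+ p = l ^+ q.+4 by congr (l ^+ _).
  by rewrite mulr1 [LHS]E !exprS; ring.
by move/mulfI => ->//; rewrite mulf_neq0.
Qed.

End Profile.

(** * Commutation modulo the branching subgroup *)

Section Core.
Import GRing.Theory.
Variables (p : nat) (gT : groupType) (G : set gT).
Hypothesis p_pr : prime p.
Hypothesis p_odd : odd p.
Hypothesis sG : is_subgroup G.
(* [Psi f] stands for the automorphism fixing the first level with sections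
   [f]; the first-level vertices are indexed by ['F_p]. *)
Variables (Psi : ('F_p -> gT) -> gT) (A : 'F_p -> gT).
Hypothesis PsiM : forall f g, Psi (fun z => f z * g z) = Psi f * Psi g.
Hypothesis AD : forall x y : 'F_p, A (x + y)%R = A x * A y.
Variables (I : finType) (b : I -> gT) (eps : I -> 'F_p -> 'F_p).
Hypothesis GA : forall z, G (A z).
Hypothesis Gb : forall i, G (b i).
Hypothesis G_min : forall H, is_subgroup H -> (forall z, H (A z)) ->
  (forall i, H (b i)) -> G `<=` H.
Hypothesis bp : forall i, b i ^+ p = 1.

(** The sections of a conjugate of a directed generator by a power of the rooted one; the directed
    section sits at [-k]. *)
Definition shifted_b i (k z : 'F_p) : gT :=
  if (z + k == 0)%R then b i else A (eps i (z + k)%R).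

Hypothesis G_shifted_b : forall i k, G (Psi (shifted_b i k)).
Hypothesis G_shift : forall f (k : 'F_p), G (Psi f) -> G (Psi (fun z => f (z + k)%R)).

Definition only_at (t : 'F_p) (x : gT) (z : 'F_p) : gT := if z == t then x else 1.

Definition branching_subgroup : set gT := [set x | G x /\ G (Psi (only_at 0%R x))].

Variable i0 : I.
Variables k1 k2 : 'F_p.
Hypothesis k10 : k1 != 0%R.
Hypothesis k20 : k2 != 0%R.
Hypothesis k12 : eps i0 k1 != eps i0 k2.

Let GP f := G (Psi f).

Let GP_ext f g : (forall z, f z = g z) -> GP f -> GP g.
Proof. by move=> /funext ->. Qed.

Let Psi_ext f g : (forall z, f z = g z) -> Psi f = Psi g.
Proof. by move=> /funext ->. Qed.

Let Psi1 : Psi (fun=> 1) = 1.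
Proof.
apply: (mulgI (Psi (fun=> 1))); rewrite mulg1 -PsiM.
by apply: Psi_ext => z; rewrite mulg1.
Qed.

Let PsiV f : Psi (fun z => (f z)^-1) = (Psi f)^-1.
Proof.
apply: (mulgI (Psi f)); rewrite mulgV -PsiM -Psi1.
by apply: Psi_ext => z; rewrite mulgV.
Qed.

Let GPM f g : GP f -> GP g -> GP (fun z => f z * g z).
Proof. by rewrite /GP PsiM; exact: is_subgroupM. Qed.

Let GPV f : GP f -> GP (fun z => (f z)^-1).
Proof. by rewrite /GP PsiV; exact: is_subgroupV. Qed.

Let GPJ f g : GP f -> GP g -> GP (fun z => f z ^ g z).
Proof. by move=> hf hg; apply: GPM (GPV hg) (GPM hf hg). Qed.

Let GPR f g : GP f -> GP g -> GP (fun z => [~ f z, g z]).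
Proof. by move=> hf hg; apply: GPM (GPV hf) (GPJ hf hg). Qed.

Let GPX f n : GP f -> GP (fun z => f z ^+ n).
Proof.
move=> hf; elim: n => [|n IHn].
  by apply: (GP_ext (f := fun=> 1)) => //; rewrite /GP Psi1; exact: is_subgroup1.
by apply: GP_ext (GPM hf IHn) => z; rewrite expgS.
Qed.

Lemma only_at_shift (s t : 'F_p) x : GP (only_at s x) -> GP (only_at t x).
Proof.
move=> /(G_shift (s - t)%R); apply: GP_ext => z.
by rewrite /only_at addrCA addrC -[X in _ == X]add0r (inj_eq (addIr _)) subr_eq0.
Qed.

Let A0 : A 0%R = 1.
Proof. by apply: (mulgI (A 0%R)); rewrite -AD addr0 mulg1. Qed.

Let AN (z : 'F_p) : A (- z)%R = (A z)^-1.
Proof. by apply: (mulgI (A z)); rewrite -AD subrr A0 mulgV. Qed.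

Let AX t n : A t ^+ n = A (t *+ n)%R.
Proof. by elim: n => [|n IHn]; rewrite ?A0// expgS IHn mulrS AD. Qed.

Let AXm t (c : 'F_p) : A t ^+ c = A (t * c)%R.
Proof. by rewrite AX -mulr_natr natr_Zp. Qed.

Let A_gen (t z : 'F_p) : t != 0%R -> exists n, A z = A t ^+ n.
Proof.
by move=> t0; exists (z / t)%R; rewrite AXm mulrC divfK.
Qed.

Let AC x y : commute (A x) (A y).
Proof. by rewrite /commute -!AD addrC. Qed.

Let eps_neq0 : exists2 k : 'F_p, k != 0%R & eps i0 k != 0%R.
Proof.
have [e1|e1] := eqVneq (eps i0 k1) 0%R; last by exists k1.
by exists k2 => //; rewrite -e1 eq_sym.
Qed.

(** A nonzero exponent of [b i0], moved to position 0, gives a generator of all the [A z], and [b i]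
    itself is the section at 0 of its shift by 0. Normality of [N] and transitivity on levels rest
    on this. *)
Lemma section_lift g : G g -> exists2 f, GP f & f 0%R = g.
Proof.
pose H : set gT := [set g | exists2 f, GP f & f 0%R = g].
suff GH : G `<=` H by move/GH.
apply: G_min => [|z|i].
- apply/is_subgroupP; split=> [|_ _ [f hf <-] [g' hg <-]|_ [f hf <-]].
  + by exists (fun=> 1) => //; rewrite /GP Psi1; exact: is_subgroup1.
  + by exists (fun z => f z * g' z) => //; exact: GPM.
  + by exists (fun z => (f z)^-1) => //; exact: GPV.
- have [k k0 ek] := eps_neq0; have [n ->] := A_gen z ek.
  exists (fun z => shifted_b i0 k z ^+ n); first exact/GPX/G_shifted_b.
  by rewrite /shifted_b add0r (negPf k0).
- exists (shifted_b i 0%R); first exact: G_shifted_b.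
  by rewrite /shifted_b addr0 eqxx.
Qed.

Let N := branching_subgroup.

Let sN : is_subgroup N.
Proof.
apply/is_subgroupP; split=> [|x y [Gx hx] [Gy hy]|x [Gx hx]].
- split; first exact: is_subgroup1.
  apply: (GP_ext (f := fun=> 1)); last by rewrite /GP Psi1; exact: is_subgroup1.
  by move=> z; rewrite /only_at if_same.
- split; first exact: is_subgroupM.
  by apply: GP_ext (GPM hx hy) => z; rewrite /only_at; case: eqP; rewrite ?mulg1.
- split; first exact: is_subgroupV.
  by apply: GP_ext (GPV hx) => z; rewrite /only_at; case: eqP; rewrite ?invg1.
Qed.

Let nN x g : N x -> G g -> N (x ^ g).
Proof.
move=> [Gx hx] Gg; split; first exact: is_subgroupJ.
have [f hf <-] := section_lift Gg; apply: GP_ext (GPJ hx hf) => z.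
by rewrite /only_at; case: eqP => [->|]; rewrite ?conj1g.
Qed.

Let pair (l : 'F_p) (x y : gT) (z : 'F_p) : gT :=
  if z == 0%R then x else if z == l then y else 1.

(** The directed sections sit at the distinct positions [0] and [-d]; everywhere else both sections
    are of the form [A z], and these commute. *)
Let commg_shifted i j (d : 'F_p) : d != 0%R ->
  GP (pair (- d)%R [~ b i, A (eps j d)] [~ A (eps i (- d)%R), b j]).
Proof.
move=> d0; apply: GP_ext (GPR (G_shifted_b i 0%R) (G_shifted_b j d)) => z.
rewrite /pair /shifted_b addr0 -addr_eq0; case: eqP => [->|z0].
  by rewrite add0r (negPf d0).
by case: eqP => [/eqP|_]; [rewrite addr_eq0 => /eqP -> | apply/eqP/commgP/AC].
Qed.

Section Mod.
Variables (Q : groupType) (pi : gT -> Q).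
Hypothesis piM : hom_on G pi.
Hypothesis pi1 : forall x, G x -> pi x = 1 <-> N x.

(** Dividing out the section that lies in [N] leaves the other one alone at its position. *)
Let pair_pi1 (l : 'F_p) x y : l != 0%R -> G x -> G y -> GP (pair l x y) ->
  pi x = 1 <-> pi y = 1.
Proof.
move=> l0 Gx Gy h; split=> [/(pi1 Gx)[_ hx]|/(pi1 Gy)[_ hy]]; apply/pi1 => //.
  split=> //; apply: (only_at_shift (s := l)).
  apply: GP_ext (GPM (GPV hx) h) => z; rewrite /only_at /pair.
  by case: eqP => [->|]; rewrite ?mulVg ?invg1 ?mul1g // eq_sym (negPf l0).
split=> //; apply: GP_ext (GPM h (GPV (only_at_shift l hy))) => z.
rewrite /only_at /pair; case: eqP => [->|_]; last by case: eqP; rewrite ?mulgV ?mulg1 ?invg1.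
by rewrite eq_sym (negPf l0) invg1 mulg1.
Qed.

Let pi_commute x y : G x -> G y -> commute (pi x) (pi y) <-> pi [~ x, y] = 1.
Proof.
by move=> Gx Gy; rewrite (homR sG)//; split=> [/commgP/eqP|/eqP/commgP].
Qed.

(** A commutator with any [Psi f] still has only two nontrivial sections, so commutation modulo [N]
    is transferred between the two positions. *)
Let pair_commute (l : 'F_p) x y f : l != 0%R -> G x -> G y -> GP (pair l x y) ->
  GP f -> G (f 0%R) -> G (f l) ->
  commute (pi x) (pi (f 0%R)) <-> commute (pi y) (pi (f l)).
Proof.
move=> l0 Gx Gy h hf G0 Gl; rewrite !pi_commute//.
apply: (pair_pi1 l0); do ?exact: is_subgroupR.
apply: GP_ext (GPR h hf) => z; rewrite /pair.
by case: eqP => [->//|_]; case: eqP => [->//|_]; rewrite comm1g.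
Qed.

Let pi_b_commute i j : commute (pi (b i)) (pi (b j)).
Proof.
apply/pi_commute => //; apply/pi1; first exact: is_subgroupR.
split; first exact: is_subgroupR.
apply: GP_ext (GPR (G_shifted_b i 0%R) (G_shifted_b j 0%R)) => z.
rewrite /only_at /shifted_b addr0; case: eqP => // _.
exact/eqP/commgP/AC.
Qed.

Let pi_A_commute x (t z : 'F_p) : t != 0%R -> commute x (pi (A t)) -> commute x (pi (A z)).
Proof.
move=> t0 xt; have [n ->] := A_gen z t0.
suff -> : pi (A t ^+ n) = pi (A t) ^+ n by exact: commuteX.
elim: n => [|n IHn]; first by rewrite !expg0 (hom1 sG piM).
by rewrite !expgS piM ?IHn//; exact: is_subgroupX.
Qed.

Let class_two u := forall i, commute (pi [~ b i, A u]) (pi (A u)) /\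
  forall j, commute (pi [~ b i, A u]) (pi (b j)).

Let class_one u : (forall i, commute (pi (b i)) (pi (A u))) -> class_two u.
Proof.
move=> H i; have /pi_commute -> // := H i.
by split=> [|j]; apply/commute_sym/commute1.
Qed.

(** The zero exponent trivialises the second section for [i0], so modulo [N] the element [b i0]
    commutes with [A (eps i0 d)], hence with every [A z]. This trivialises the second section for
    every [i] modulo [N]. *)
Let class_two_of_zero (d : 'F_p) : d != 0%R -> eps i0 d != 0%R -> eps i0 (- d)%R = 0%R ->
  class_two (eps i0 d).
Proof.
move=> d0 ed edN; have dN0 : (- d != 0)%R by rewrite oppr_eq0.
have GR i z : G [~ b i, A z] by exact: is_subgroupR.
have GR' i z : G [~ A z, b i] by exact: is_subgroupR.
have b0 : pi [~ b i0, A (eps i0 d)] = 1.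
  apply/(pair_pi1 dN0 _ _ (commg_shifted i0 i0 d0)) => //.
  by rewrite edN A0 comm1g (hom1 sG piM).
apply: class_one => i; apply/pi_commute => //.
apply/(pair_pi1 dN0 _ _ (commg_shifted i i0 d0)) => //.
apply/pi_commute => //; apply/commute_sym/(pi_A_commute _ ed).
exact/pi_commute.
Qed.

(* Two independent vectors of exponents at the positions [0] and [-d] provide
   elements with a trivial section at one of them and [A t], [t <> 0], at the
   other. *)
Let class_two_of_independent (d : 'F_p) i1 i2 (l1 l2 : 'F_p) :
  d != 0%R -> eps i0 d != 0%R ->
  l1 != 0%R -> l1 != d -> l2 != 0%R -> l2 != d ->
  (eps i1 l1 * eps i2 (l2 - d) != eps i2 l2 * eps i1 (l1 - d))%R ->
  class_two (eps i0 d).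
Proof.
move=> d0 ed l10 l1d l20 l2d ind; have dN0 : (- d != 0)%R by rewrite oppr_eq0.
have GR i z : G [~ b i, A z] by exact: is_subgroupR.
have GR' i z : G [~ A z, b i] by exact: is_subgroupR.
have GS i k z : G (shifted_b i k z) by rewrite /shifted_b; case: eqP.
have S0 i k : k != 0%R -> shifted_b i k 0%R = A (eps i k).
  by move=> k0; rewrite /shifted_b add0r (negPf k0).
have Sd i k : k != d -> shifted_b i k (- d)%R = A (eps i (k - d)%R).
  by move=> kd; rewrite /shifted_b addrC subr_eq0 (negPf kd).
pose f (c1 c2 : 'F_p) z := shifted_b i1 l1 z ^+ c1 * shifted_b i2 l2 z ^+ c2.
have hf c1 c2 : GP (f c1 c2) by apply: GPM; apply: GPX; exact: G_shifted_b.
have Gf c1 c2 z : G (f c1 c2 z) by apply: is_subgroupM => //; apply: is_subgroupX => //; exact: GS.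
have f0 c1 c2 : f c1 c2 0%R = A (eps i1 l1 * c1 + eps i2 l2 * c2)%R.
  by rewrite /f !S0// !AXm AD.
have fd c1 c2 : f c1 c2 (- d)%R =
    A (eps i1 (l1 - d) * c1 + eps i2 (l2 - d) * c2)%R.
  by rewrite /f !Sd// !AXm AD.
move=> i; set x := [~ b i, _]; set y := [~ A (eps i (- d)%R), b i0].
have h : GP (pair (- d)%R x y) by exact: commg_shifted.
have Gx : G x by exact: GR.
have Gy : G y by exact: GR'.
(* The coefficients kill the section at [-d] and leave the nonzero determinant as exponent at [0];
   in [yA] the two positions exchange roles. *)
have xA z : commute (pi x) (pi (A z)).
  have /pi_A_commute : (eps i1 l1 * eps i2 (l2 - d) + eps i2 l2 * - eps i1 (l1 - d) != 0)%R.
    by rewrite mulrN subr_eq0.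
  apply; rewrite -f0; apply/(pair_commute dN0 _ _ h (hf _ _)) => //.
  rewrite fd (_ : _ + _ = 0)%R; last by ring.
  by rewrite A0 (hom1 sG piM); exact: commute1.
have yA z : commute (pi y) (pi (A z)).
  have /pi_A_commute : (eps i1 (l1 - d) * eps i2 l2 + eps i2 (l2 - d) * - eps i1 l1 != 0)%R.
    by rewrite mulrN subr_eq0 eq_sym mulrC [X in _ != X]mulrC.
  apply; rewrite -fd; apply/(pair_commute dN0 _ _ h (hf _ _)) => //.
  rewrite f0 (_ : _ + _ = 0)%R; last by ring.
  by rewrite A0 (hom1 sG piM); exact: commute1.
(* The shift of [b j] by 0 has section [b j] at [0] and some [A z] at [-d]; so [yA] yields that [x]
   commutes with [b j] modulo [N]. *)
split=> // j; have := pair_commute dN0 Gx Gy h (G_shifted_b j 0%R) (GS _ _ _) (GS _ _ _).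
rewrite {1}/shifted_b addr0 eqxx => -[_]; apply.
by rewrite /shifted_b addr0 (negPf dN0).
Qed.

(* [Psi (x, y)] with [x = [b, A u]] and [y = x^(A u)^-1] at the positions [0]
   and [-d] is moved around by conjugation and by the cyclic shift until the
   positions match. *)
Let class_one_of_antisymmetric i (d : 'F_p) : p = 3 -> d != 0%R ->
  eps i d != 0%R -> eps i (- d)%R = (- eps i d)%R ->
  commute (pi (b i)) (pi (A (eps i d))).
Proof.
move=> p3 d0 ed edN; set u := A (eps i d); set x := [~ b i, u].
have d3 : (d + d + d = 0)%R.
  have -> : (d + d + d = 3%:R * d)%R by ring.
  by rewrite -[X in (X%:R * _)%R]p3 (pcharf0 (pchar_Fp p_pr)) mul0r.
have dd : (- d - d = d)%R by apply/eqP; rewrite -subr_eq0 -!opprD oppr_eq0 d3.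
have dN0 : (- d != 0)%R by rewrite oppr_eq0.
have dNd : (d != - d)%R by rewrite -addr_eq0 (Fp_double_neq0 p_pr p_odd).
set y := x ^ u^-1.
have yE : y = [~ A (eps i (- d)%R), b i].
  by rewrite edN AN /y /x /commg /conjg -/u !invgK !mulgA mulgK.
have Gx : G x := is_subgroupR sG (Gb i) (GA _).
have Gu : G u := GA _.
have Gy : G y := is_subgroupJ sG Gx (is_subgroupV sG Gu).
have g1 : GP (pair (- d)%R x y) by rewrite yE; exact: commg_shifted.
(* The conjugating element has sections [u^-1] at [0] and [u] at [-d], as [-2d = d]; it exchanges
   [x] and [y]. *)
have g2 : GP (pair (- d)%R y x).
  apply: GP_ext (GPJ g1 (G_shifted_b i (- d)%R)) => z; rewrite /pair /shifted_b.
  case: eqP => [->|_]; first by rewrite add0r (negPf dN0) edN AN.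
  case: eqP => [->|_]; last by rewrite conj1g.
  by rewrite dd (negPf d0) /y conjgKV.
(* The shift of [g1] has [y] at [0] and [x] at [d]. Dividing [g2] by it clears position [0], and a
   further shift brings [x] to [0] and [x^-1] to [-d]. *)
have g4 : GP (pair (- d)%R x x^-1).
  have g3 := GPM g2 (GPV (G_shift (- d)%R g1)).
  apply: GP_ext (G_shift (- d)%R g3) => z; rewrite /pair.
  have e1 : (z - d == 0)%R = (z == d) by rewrite subr_eq0.
  have e2 : (z - d == - d)%R = (z == 0%R).
    by rewrite -[X in _ == X]add0r (inj_eq (addIr _)).
  have e3 : (z - d - d == 0)%R = (z == - d)%R by rewrite -addrA dd addr_eq0.
  have e4 : (z - d - d == - d)%R = (z == d).
    by rewrite -[X in _ == X]add0r (inj_eq (addIr _)).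
  rewrite e1 e2 e3 e4; have [->|z0] := eqVneq z 0%R.
    by rewrite eq_sym (negPf d0) eq_sym (negPf dN0) invg1 mulg1.
  have [->|zd] := eqVneq z d; first by rewrite (negPf dNd) mulgV.
  by case: eqP; rewrite mul1g ?invg1.
have Nyx : N (y^-1 * x^-1).
  split; first by apply: is_subgroupM => //; exact: is_subgroupV.
  apply: (only_at_shift (s := (- d)%R)).
  apply: GP_ext (GPM (GPV g1) g4) => z; rewrite /pair /only_at.
  case: eqP => [->|_]; first by rewrite mulVg eq_sym (negPf dN0).
  by case: eqP; rewrite ?invg1 ?mulg1.
have GVx : G x^-1 by exact: is_subgroupV.
have GVu : G u^-1 by exact: is_subgroupV.
have GVy : G y^-1 by exact: is_subgroupV.
have piyx : pi y = (pi x)^-1.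
  have := (pi1 (is_subgroupM sG GVy GVx)).2 Nyx.
  by rewrite piM// !(homV sG piM)// => /mulg1_eq; rewrite invgK.
apply: inverted_commutator.
  rewrite -p3; have := AX (eps i d) p; rewrite -/u -mulr_natr.
  rewrite (pcharf0 (pchar_Fp p_pr)) mulr0 A0 => up.
  suff -> : pi u ^+ p = pi (u ^+ p) by rewrite up (hom1 sG piM).
  elim: p => [|n IHn]; first by rewrite !expg0 (hom1 sG piM).
  by rewrite !expgS piM ?IHn//; exact: is_subgroupX.
by rewrite -(homR sG piM)// -(homV sG piM)// -(homJ sG piM).
Qed.

Let class_two_exists : exists2 u, u != 0%R & class_two u.
Proof.
case: (nonconstant_profile p_pr p_odd k10 k20 k12).
- by move=> [d [d0 ed edN]]; exists (eps i0 d) => //; exact: class_two_of_zero.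
- move=> [d [k [k' [d0 ed edN [? ? ? ?] ind]]]]; exists (eps i0 d) => //.
  exact: class_two_of_independent ind.
move=> [p3 anti]; have /anti[e1 eN1] : (1 != 0 :> 'F_p)%R by exact: oner_neq0.
exists (eps i0 1%R) => //; have N10 : (- 1 != 0 :> 'F_p)%R by rewrite oppr_eq0 oner_neq0.
have N11 : (- 1 != 1 :> 'F_p)%R.
  by rewrite eq_sym -addr_eq0 (Fp_double_neq0 p_pr p_odd)// oner_neq0.
have N2 : (- 1 - 1 = 1 :> 'F_p)%R.
  apply/eqP; rewrite -subr_eq0 (_ : - 1 - 1 - 1 = - 3%:R)%R; last by ring.
  rewrite oppr_eq0; by rewrite -(dvdn_pcharf (pchar_Fp p_pr)) [X in (X %| _)%N]p3.
(* A generator not of the form [(u, -u)] is independent of [b i0]. Otherwise all are of this form,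
   and one with [u = 0] has a trivial second section in [commg_shifted]. *)
have [[i ni]|H] := pselect (exists i, eps i (- 1)%R != (- eps i 1)%R).
  apply: (@class_two_of_independent 1%R i0 i (- 1)%R (- 1)%R) => //.
  rewrite N2 eN1 -subr_eq0 (_ : _ - _ = - eps i0 1 * (eps i (-1) + eps i 1))%R; last by ring.
  by rewrite mulf_neq0 ?oppr_eq0// addr_eq0.
apply: class_one => i; have {H} Hi : eps i (- 1)%R = (- eps i 1)%R.
  by apply/eqP/negPn/negP => h; apply: H; exists i.
have [ei|ei] := eqVneq (eps i 1%R) 0%R; last first.
  apply: (pi_A_commute _ ei); apply: class_one_of_antisymmetric => //.
apply/pi_commute => //.
apply/(pair_pi1 N10 _ _ (commg_shifted i i0 (oner_neq0 _))); do ?exact: is_subgroupR.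
by rewrite Hi ei oppr0 A0 comm1g (hom1 sG piM).
Qed.

Lemma quotient_fin_idx : fin_idx G N.
Proof.
have [u u0 cu] := class_two_exists.
have piX n x : G x -> pi (x ^+ n) = pi x ^+ n.
  move=> Gx; elim: n => [|n IHn]; first by rewrite !expg0 (hom1 sG piM).
  by rewrite !expgS piM ?IHn//; exact: is_subgroupX.
have [||||||J [F FP]] := @class_two_finite Q I p (pi (A u)) (pi \o b).
- exact: prime_gt0.
- rewrite -piX// AX -mulr_natr (pcharf0 (pchar_Fp p_pr)) mulr0 A0.
  exact: hom1 piM.
- by move=> i; rewrite /= -piX// bp (hom1 sG piM).
- by move=> i j; exact: pi_b_commute.
- by move=> i; rewrite /= -(homR sG piM)//; exact: (cu i).1.
- by move=> i j; rewrite /= -(homR sG piM)//; exact: (cu i).2.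
have GF x : G x -> exists j, F j = pi x.
  have : G `<=` G `&` pi @^-1` generated ([set pi (A u)] `|` range (pi \o b)).
    apply: G_min => [|z|i].
    - by apply: preimage_subgroup => //; exact: generated_subgroup.
    - split=> //; have [n ->] := A_gen z u0; rewrite /preimage/= piX//.
      apply: (is_subgroupX n (generated_subgroup _)); apply: mem_generated; by left.
    - by split=> //; apply: mem_generated; right; exists i.
  by move=> H /H[_ /FP[j _ <-]]; exists j.
have /choice[c cP] x : exists j, G x -> F j = pi x.
  have [/GF[j jE]|nGx] := pselect (G x); first by exists j.
  by have [j _] := GF 1 (is_subgroup1 sG); exists j.
exists J, c => x y Gx Gy e; apply/pi1; first by apply: is_subgroupM => //; exact: is_subgroupV.
by rewrite (hom_div sG piM)// -!cP// e mulgV.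
Qed.

End Mod.

Lemma fin_idx_branching_subgroup : fin_idx G branching_subgroup.
Proof.
have [|Q [pi [piM pi1 _]]] := quotient_exists sG sN _ nN; first by move=> x [].
exact: quotient_fin_idx piM pi1.
Qed.

End Core.

(** * Spinal groups *)

Section Sections.
Import GRing.Theory.
Variable p : nat.
Hypothesis p_pr : prime p.
Notation Aut := (tree_aut (regular_tree p)).
Implicit Types (x : 'I_p) (f g : 'F_p -> Aut) (w : seq 'I_p).

(* The inverse of [psi_1], a letter [x] being identified with [x%:R]. *)
Definition of_sections f : Aut := spinal (fun x => Some (f x%:R%R)).

Lemma of_sectionsE f x w : of_sections f (x :: w) = x :: f x%:R%R w.
Proof. by []. Qed.

Lemma of_sectionsM f g :
  of_sections (fun z => f z * g z) = of_sections f * of_sections g.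
Proof. by apply: tree_autP => -[]. Qed.

Let charFp := pchar_Fp p_pr.

Let p_gt0 : 0 < p. Proof. exact: prime_gt0. Qed.

Let natFp_mod n : ((n %% p)%:R = n%:R :> 'F_p)%R.
Proof. by rewrite {2}(divn_eq n p) natrD natrM (pcharf0 charFp) mulr0 add0r. Qed.

Let val_Fp_lt (z : 'F_p) : z < p.
Proof. by apply: leq_trans (ltn_ord z) _; rewrite Fp_cast. Qed.

Let val_natFp n : (n%:R%R : 'F_p) = n %% p :> nat.
Proof. by rewrite val_Fp_nat. Qed.

Definition letter (z : 'F_p) : 'I_p := Ordinal (val_Fp_lt z).

Lemma letterK z : ((letter z)%:R = z)%R.
Proof. exact: natr_Zp. Qed.

Lemma letter_inj (x y : 'I_p) : (x%:R = y%:R :> 'F_p)%R -> x = y.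
Proof.
by move=> /(congr1 (@nat_of_ord _)); rewrite !val_natFp !modn_small// => /ord_inj.
Qed.

Lemma rooted_aX n x w :
  (rooted_a p ^+ n) (x :: w) = Ordinal (ltn_pmod (x + n) p_gt0) :: w.
Proof.
elim: n => [|n IHn].
  by rewrite expg0; congr (_ :: _); apply: val_inj; rewrite /= addn0 modn_small.
rewrite expgSr tautM IHn; congr (_ :: _); apply: val_inj => /=.
by rewrite -addn1 modnDml addn1 addnS.
Qed.

Lemma rooted_a_nil n : (rooted_a p ^+ n) [::] = [::].
Proof. exact: (tree_aut_root (rooted_a p ^+ n)). Qed.

Lemma rooted_aXp : rooted_a p ^+ p = 1.
Proof.
apply: tree_autP => -[|x w]; first by rewrite rooted_a_nil.
rewrite rooted_aX; congr (_ :: _); apply: val_inj.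
by rewrite /= modnDr modn_small.
Qed.

Definition a_power (z : 'F_p) : Aut := rooted_a p ^+ z.

Lemma a_powerD (y z : 'F_p) : a_power (y + z)%R = a_power y * a_power z.
Proof.
rewrite /a_power -expgnDr [X in _ = _ ^+ X](divn_eq _ p) expgnDr mulnC expgnA.
rewrite rooted_aXp expg1n mul1g; congr (_ ^+ _).
by congr (_ %% _); exact: Fp_cast.
Qed.

Lemma of_sections_rooted f n :
  of_sections f ^ (rooted_a p ^- n) = of_sections (fun z => f (z + n%:R)%R).
Proof.
apply: tree_autP => v; rewrite /conjg invgK !tautM.
case: v => [|x w]; first by rewrite rooted_a_nil (tree_aut_root (rooted_a p ^- n)).
rewrite rooted_aX !of_sectionsE -natrD -natFp_mod -[in RHS]natFp_mod.
apply: (@taut_inj _ (rooted_a p ^+ n)); rewrite tautKV rooted_aX.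
by rewrite /= modn_mod.
Qed.

(* [e_(m-1)] for [m <> 0], in the 0-based numbering of the entries. *)
Definition exponent (e : 'rV['F_p]_p.-1) (m : 'F_p) : 'F_p :=
  if m == 0%R then 0%R else nth 0%R [seq e 0%R i | i <- enum 'I_p.-1] (m : nat).-1.

(** With 0-based letters the directed section is at [x = p - 1 - j], that is where [x + j + 1]
    vanishes modulo [p]; at any other letter this residue is the 1-based index of the exponent. *)
Lemma directed_b_sections (j : 'I_p) e :
  directed_b j e = of_sections
    (shifted_b a_power (fun e => directed_b j e) exponent e j.+1%:R%R).
Proof.
apply: tree_autP => -[//|x w]; rewrite directed_bE of_sectionsE; congr (_ :: _ w).
rewrite /shifted_b -natrD -(dvdn_pcharf charFp) /exponent -(dvdn_pcharf charFp).
rewrite val_natFp.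
have sP : size (a_powers e) = p.-1 by rewrite size_map size_enum_ord.
have nP k : nth 1 (a_powers e) k =
    a_power (nth 0%R [seq e 0%R i | i <- enum 'I_p.-1] k).
  rewrite /a_powers; elim: (enum _) k => [|i s IHs] [|k] //=.
rewrite nth_cat size_drop sP; have jp := ltn_ord j; have xp := ltn_ord x.
case: ltnP => xj.
  have h : x + j.+1 < p by rewrite addnS; lia.
  have h0 : 0 < x + j.+1 by rewrite addnS.
  rewrite nth_drop nP gtnNdvd// modn_small//; congr (a_power (nth _ _ _)); lia.
have [xE|xj'] := eqVneq (x : nat) (p.-1 - j)%N.
  rewrite xE subnn /= (_ : p %| _)//.
  by rewrite (_ : _ + _ = p)%N//; lia.
have [k kE] : exists k, x = (k + (p.-1 - j).+1)%N :> nat.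
  by exists (x - (p.-1 - j).+1)%N; lia.
have xj1 : x + j.+1 = (k.+1 + p)%N by lia.
rewrite xj1 kE addnS subSn ?leq_addl// addnK /= nth_take ?nP; last by lia.
by rewrite dvdn_addl// modnDr modn_small ?gtnNdvd//; lia.
Qed.

End Sections.

Section SpinalGroup.
Import GRing.Theory.
Variable p : nat.
Hypothesis p_pr : prime p.
Hypothesis p_odd : odd p.
Variable E : 'I_p -> seq 'rV['F_p]_p.-1.
Notation Aut := (tree_aut (regular_tree p)).
Notation G := (spinal_group E).
Notation Psi := (@of_sections p).

Let sG : is_subgroup G. Proof. exact: generated_subgroup. Qed.

(** The index [j] is kept because one vector may occur in several families. *)
Let I := seq_sub [seq (j, e) | j <- enum 'I_p, e <- E j].
Let b (i : I) : Aut := directed_b (val i).1 (val i).2.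
Let eps (i : I) := exponent (val i).2.

Let p_gt1 : 1 < p. Proof. exact: prime_gt1. Qed.

Let Ga : G (rooted_a p).
Proof. by apply: mem_generated; left. Qed.

Let GA z : G (a_power z).
Proof. exact: (is_subgroupX _ sG Ga). Qed.

Let index_mem j e : e \in E j -> exists i : I, val i = (j, e).
Proof.
move=> je; have h : (j, e) \in [seq (j, e) | j <- enum 'I_p, e <- E j].
  by apply/allpairsPdep; exists j, e; rewrite mem_enum.
by exists (SeqSub h).
Qed.

Let Gb i : G (b i).
Proof.
have /allpairsPdep[j [e [_ je ie]]] := valP i.
by apply: mem_generated; right; exists j, e => //; rewrite /b ie.
Qed.

Let G_min H : is_subgroup H -> (forall z : 'F_p, H (a_power z)) ->
  (forall i, H (b i)) -> G `<=` H.
Proof.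
move=> sH HA Hb; apply: generated_min => // _ [->|[j [e je ->]]].
  suff -> : rooted_a p = a_power 1%R by [].
  by rewrite /a_power /= Fp_cast// modn_small.
by have [i ie] := index_mem je; have := Hb i; rewrite /b ie.
Qed.

(** Induction on words: the directed section acts on a shorter word, and the other sections are
    powers of the rooted automorphism. *)
Lemma directed_bXp (j : 'I_p) e : directed_b j e ^+ p = 1 :> Aut.
Proof.
have PsiX (f : 'F_p -> Aut) n x w :
    (Psi f ^+ n) (x :: w) = x :: (f x%:R%R ^+ n) w.
  elim: n w => [|n IHn] w; first by rewrite !expg0.
  by rewrite !expgSr !tautM IHn of_sectionsE.
apply: tree_autP; elim=> [|x w IHw]; first exact: (tree_aut_root (directed_b j e ^+ p)).
rewrite {1}(directed_b_sections p_pr) PsiX /shifted_b; case: eqP => _.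
  by rewrite IHw.
by rewrite /a_power -expgnA mulnC expgnA (rooted_aXp p_pr) expg1n.
Qed.

Let G_shift f (k : 'F_p) : G (Psi f) -> G (Psi (fun z => f (z + k)%R)).
Proof.
move=> hf; rewrite -[k]natr_Zp -(of_sections_rooted p_pr).
exact: (is_subgroupJ sG hf (is_subgroupV sG (is_subgroupX _ sG Ga))).
Qed.

Let G_shifted_b i k : G (Psi (shifted_b (@a_power p) b eps i k)).
Proof.
have := Gb i; rewrite {1}/b (directed_b_sections p_pr).
move=> /(G_shift (k - (val i).1.+1%:R)%R).
congr (G (Psi _)); apply: funext => z; rewrite /shifted_b /eps -addrA.
by rewrite subrK.
Qed.

Let of_sections_ext (f g : 'F_p -> Aut) : (forall z, f z = g z) -> Psi f = Psi g.
Proof. by move=> /funext ->. Qed.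

Let of_sections1 : Psi (fun=> 1) = 1.
Proof. by apply: tree_autP => -[]. Qed.

Let of_sectionsV (f : 'F_p -> Aut) : Psi (fun z => (f z)^-1) = (Psi f)^-1.
Proof.
apply: (mulgI (Psi f)); rewrite mulgV -of_sectionsM -of_sections1.
by apply: of_sections_ext => z; rewrite mulgV.
Qed.

Lemma self_similar x : G x ->
  exists (f : 'F_p -> Aut) n, (forall z, G (f z)) /\ x = Psi f * rooted_a p ^+ n.
Proof.
pose P y := exists (f : 'F_p -> Aut) n, (forall z, G (f z)) /\ y = Psi f * rooted_a p ^+ n.
move: x; apply: (@generated_ind _ _ P).
  by exists (fun=> 1), 0%N; split=> [_|]; [exact: is_subgroup1 sG | rewrite of_sections1 mulg1].
(* Moving a power of the rooted automorphism to the right past [Psi g] shifts the sections [g]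
   cyclically. *)
have PM f g n : (forall z, G (f z)) -> (forall z, G (g z)) ->
    P (Psi f * rooted_a p ^+ n * Psi g).
  move=> Gf Gg; exists (fun z => f z * g (z + n%:R)%R), n; split=> [z|].
    exact: (is_subgroupM sG (Gf z) (Gg _)).
  rewrite of_sectionsM -(of_sections_rooted p_pr) /conjg invgK.
  by rewrite -!mulgA mulVg mulg1.
have aV : (rooted_a p)^-1 = rooted_a p ^+ p.-1.
  apply: (mulgI (rooted_a p)); rewrite mulgV -expgS prednK ?(rooted_aXp p_pr)//.
  exact: ltnW.
move=> _ y [f [n [Gf ->]]] [->|[j [e je ->]]].
  split; first by exists f, n.+1; rewrite -mulgA -expgSr.
  by exists f, (n + p.-1)%N; rewrite aV -mulgA -expgnDr.
have [i ie] := index_mem je.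
have Gs z : G (shifted_b (@a_power p) b eps i j.+1%:R%R z).
  by rewrite /shifted_b; case: eqP => _; [exact: Gb | exact: GA].
have bE : directed_b j e = Psi (shifted_b (@a_power p) b eps i j.+1%:R%R).
  rewrite (directed_b_sections p_pr); apply: of_sections_ext => z.
  by rewrite /shifted_b /b /eps ie.
by rewrite bE -of_sectionsV; split; apply: PM => // z; exact: (is_subgroupV sG (Gs z)).
Qed.

Hypothesis nonconstant : exists j e,
  e \in E j /\ ~ exists alpha : 'F_p, e = const_mx alpha.

Let nonconstant_exponent : exists i (k1 k2 : 'F_p),
  [/\ k1 != 0%R, k2 != 0%R & eps i k1 != eps i k2].
Proof.
have [j [e [je enc]]] := nonconstant; have [i ie] := index_mem je.
have expE (k : 'I_p.-1) : k.+1%:R%R != 0%R :> 'F_p /\ eps i k.+1%:R%R = e 0%R k.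
  have kp : k.+1 < p by rewrite -ltn_predRL.
  have k0 : k.+1%:R%R != 0%R :> 'F_p.
    by rewrite -(dvdn_pcharf (pchar_Fp p_pr)) gtnNdvd.
  split=> //; rewrite /eps ie /exponent (negPf k0) val_Fp_nat// modn_small//=.
  by rewrite (nth_map k) ?size_enum_ord// nth_ord_enum.
apply: contrapT => H; apply: enc.
have p10 : 0 < p.-1 by rewrite ltn_predRL.
exists (e 0%R (Ordinal p10)); apply/rowP => k; rewrite mxE.
apply: contrapT => /eqP ek; apply: H.
exists i, k.+1%:R%R, (Ordinal p10).+1%:R%R.
by rewrite !(expE _).2; split=> //; exact: (expE _).1.
Qed.

Let place (z : 'F_p) (g : Aut) : Aut := Psi (only_at z g).

Let placeM z g h : place z (g * h) = place z g * place z h.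
Proof.
rewrite -of_sectionsM; apply: of_sections_ext => y.
by rewrite /only_at; case: eqP; rewrite ?mulg1.
Qed.

Lemma fin_idx_place z : fin_idx G [set x | G x /\ G (place z x)].
Proof.
have [i [k1 [k2 [k10 k20 k12]]]] := nonconstant_exponent.
have := fin_idx_branching_subgroup p_pr p_odd sG (@of_sectionsM p)
  (a_powerD p_pr) GA Gb G_min (fun i => directed_bXp _ _) G_shifted_b G_shift
  k10 k20 k12.
by apply: fin_idxW => x [Gx hx]; split=> //; exact: only_at_shift hx.
Qed.

Lemma spinal_group_transitive n (u v : seq 'I_p) :
  size u = n -> size v = n -> exists2 x, G x & x u = v.
Proof.
have [i [k1 [k2 [k10 k20 k12]]]] := nonconstant_exponent.
elim: n u v => [|n IHn] [|x u] [|y v] //=; first by exists 1 => //; exact: is_subgroup1 sG.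
move=> [su] [sv]; have [g Gg guv] := IHn u v su sv.
have [f Gf f0] := section_lift sG (@of_sectionsM p) (a_powerD p_pr) G_min G_shifted_b k10 k20 k12 Gg.
(* The shift puts the section [g] at the letter [x]; then [x] is rotated to [y], where adding [p]
   keeps the exponent a true difference of naturals. *)
exists (Psi (fun z => f (z - x%:R)%R) * rooted_a p ^+ (y + p - x)).
  exact: (is_subgroupM sG (G_shift _ Gf) (is_subgroupX _ sG Ga)).
rewrite tautM of_sectionsE subrr f0 guv (rooted_aX p_pr); congr (_ :: _).
apply: val_inj; rewrite /= subnKC ?modnDr ?modn_small//.
by apply: ltnW; apply: leq_trans (leq_addl _ _).
Qed.

(** Elements are coloured by the colours of their [p] sections and their rotation modulo [p]. The
    quotient of two elements of one colour fixes the first level and is a product of elements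
    [place z (f z)] of [M]. *)
Lemma fin_idx_first_level M : is_subgroup M ->
  (forall z, fin_idx G [set g | M (place z g)]) -> fin_idx G M.
Proof.
move=> sM fM.
pose J z := projT1 (cid (fM z)).
pose c z : Aut -> J z := projT1 (cid (projT2 (cid (fM z)))).
have cP z := projT2 (cid (projT2 (cid (fM z)))).
have H x : exists fn : ('F_p -> Aut) * nat, G x ->
    (forall z, G (fn.1 z)) /\ x = Psi fn.1 * rooted_a p ^+ fn.2.
  have [/self_similar[f [n h]]|nGx] := pselect (G x); first by exists (f, n).
  by exists (fun=> 1, 0%N).
have {H} [h hP] := choice H.
exists ({dffun forall z, J z} * 'I_p)%type.
exists (fun x => ([ffun z => c z ((h x).1 z)] : {dffun forall z, J z},
  Ordinal (ltn_pmod (h x).2 (ltnW p_gt1)))) => x y Gx Gy [/ffunP ec en].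
have [Gfx xE] := hP _ Gx; have [Gfy yE] := hP _ Gy.
have an : rooted_a p ^+ (h x).2 = rooted_a p ^+ (h y).2.
  rewrite (divn_eq (h x).2 p) (divn_eq (h y).2 p) en !expgnDr.
  by rewrite ![(_ * p)%N]mulnC !expgnA (rooted_aXp p_pr) !expg1n.
rewrite xE yE an mulgKA -of_sectionsV -of_sectionsM; set f := fun z => _ * _.
have Mf z : M (place z (f z)).
  by apply: cP => //; have := ec z; rewrite !ffunE.
have {Mf} Mr (r : seq 'F_p) : M (Psi (fun z => if z \in r then f z else 1)).
  elim: r => [|y0 r IHr]; first by rewrite of_sections1; exact: is_subgroup1.
  have [yr|yr] := boolP (y0 \in r).
    rewrite (of_sections_ext (g := fun z => if z \in r then f z else 1))// => z.
    by rewrite inE; case: eqP => // ->; rewrite yr.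
  rewrite (of_sections_ext (g := fun z => only_at y0 (f y0) z * (if z \in r then f z else 1))).
    by rewrite of_sectionsM; apply: is_subgroupM => //; exact: Mf.
  move=> z; rewrite inE /only_at; case: eqP => [->|_] /=; last by rewrite mul1g.
  by rewrite (negPf yr) mulg1.
have := Mr (enum 'F_p); congr M; apply: of_sections_ext => z.
by rewrite mem_enum.
Qed.

Notation rist := (rigid_stabiliser G (@id Aut)).

Let rist_place z g v : rist v g -> G (place z g) ->
  rist (letter p_pr z :: v) (place z g).
Proof.
move=> [Gg gv] Gz; split=> // -[//|y w] nd.
rewrite [LHS]of_sectionsE /only_at.
case: eqP => // yz; rewrite gv// => -[n]; rewrite iter_word_parent => e; apply: nd.
have yE : y = letter p_pr z by apply: (letter_inj p_pr); rewrite letterK.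
have nw : size v <= size w by rewrite -e size_takel ?leq_subr.
exists (size w - size v)%N; rewrite iter_word_parent /= subSn ?leq_subr// subKn//=.
by rewrite yE -[X in take X _](congr1 size e) size_takel ?leq_subr// e.
Qed.

(** Induction on the level: [place z] pushes rigid stabilisers one level down where its values stay
    in [G], which by [fin_idx_place] is a condition of finite index. The set [K] accumulates these
    conditions. *)
Lemma fin_idx_rigid n K M : is_subgroup M -> fin_idx G K ->
  (forall v : regular_tree p, size v = n -> rist v `&` K `<=` M) ->
  fin_idx G M.
Proof.
elim: n K M => [|n IHn] K M sM fK KM.
  have [J [c cP]] := fK; exists J, c => x y Gx Gy e.
  apply: (KM [::] erefl); split; last exact: cP.
  split=> [|v]; first exact: (is_subgroupM sG Gx (is_subgroupV sG Gy)).
  by case; exists (size v); rewrite iter_word_parent subnn take0.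
apply: fin_idx_first_level => // z.
pose Nz : set Aut := [set x | G x /\ G (place z x)].
have place_hom : hom_on Nz (place z) by move=> g h _ _; exact: placeM.
have sNz : is_subgroup Nz.
  have := preimage_subgroup sG (f := place z) _ sG.
  by apply=> g h _ _; exact: placeM.
have fKz : fin_idx G (Nz `&` place z @^-1` K).
  apply: (fin_idx_trans (is_subgroup1 sG) (fin_idx_place z)).
  by apply: (fin_idx_preimage sNz place_hom (G' := G)) => // x [].
apply: (IHn _ _ _ fKz) => [|v sv g [gv [[Gg Gz] Kz]]].
  apply/is_subgroupP; split=> [|g h Mg Mh|g Mg] /=.
  - suff -> : place z 1 = 1 by exact: is_subgroup1.
    by rewrite -[RHS]of_sections1; apply: of_sections_ext => y; rewrite /only_at if_same.
  - by rewrite placeM; exact: is_subgroupM.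
  - suff -> : place z g^-1 = (place z g)^-1 by exact: is_subgroupV.
    rewrite -of_sectionsV; apply: of_sections_ext => y; rewrite /only_at.
    by case: eqP => //; rewrite invg1.
apply: (KM (letter p_pr z :: v)) => /=; first by rewrite sv.
by split=> //; exact: rist_place.
Qed.

Lemma spinal_group_branch_on : branch_on G (@id Aut).
Proof.
split.
- by split=> // x _ x1; apply: tree_autP.
- by move=> u v uv; exact: (spinal_group_transitive (n := size u)).
- move=> n M sM _ rM; apply: (fin_idx_rigid (n := n) (K := setT) sM).
    by exists unit, (fun=> tt).
  by move=> v sv x [/(rM v sv)].
Qed.

Lemma spinal_group_fg : exists s : seq Aut, G = generated [set` s].
Proof.
exists (rooted_a p :: [seq directed_b j e | j <- enum 'I_p, e <- E j]).
congr generated; apply/seteqP; split=> [_ [->|[j [e je ->]]]|x /=].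
- exact: mem_head.
- rewrite /= inE; apply/orP; right; apply/allpairsPdep.
  by exists j, e; rewrite mem_enum.
- rewrite inE => /predU1P[->|/allpairsPdep[j [e [_ je ->]]]]; first by left.
  by right; exists j, e.
Qed.

End SpinalGroup.

Lemma conjugate_generated (gT : groupType) (s : seq gT) g :
  conjugate (generated [set` s]) g = generated [set` [seq x ^ g | x <- s]].
Proof.
have JM : hom_on setT (fun x : gT => x ^ g) by move=> x y _ _; exact: conjMg.
have sT : is_subgroup [set: gT] by exact/is_subgroupP.
apply/seteqP; split.
  move=> _ [x sx <-]; suff /(_ x sx) [] : generated [set` s] `<=`
    setT `&` (fun x => x ^ g) @^-1` generated [set` [seq x ^ g | x <- s]] by [].
  apply: generated_min => [|y sy].
    by apply: preimage_subgroup => //; exact: generated_subgroup.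
  by split=> //; apply: mem_generated; exact: map_f.
apply: generated_min => [|_ /mapP[x sx ->]].
  by apply: (image_subgroup sT JM) => //; exact: generated_subgroup.
by exists x => //; exact: mem_generated.
Qed.

Local Close Scope group_scope.

Theorem corollary3p12 (p : nat) (p_prime : prime p) (p_odd : odd p)
    (G : set (tree_aut (regular_tree p))) (GC : C_reg G) :
  ~ countable [set O : set (set (tree_aut (regular_tree p))) |
      (exists2 H, weakly_maximal G H & O = aut_orbit G H) /\
      forall (T' : rootedTree)
             (alpha : tree_aut (regular_tree p) -> tree_aut T')
             (xi : nat -> T'),
        spherically_homogeneous T' -> branch_action G alpha -> boundary xi ->
        O <> aut_orbit G (parabolic G alpha xi)].
Proof.
have [E [[_ [j Ej] _] regE [g GE]]] := GC.
have nonconst : exists j e, e \in E j /\ ~ exists alpha : 'F_p, e = const_mx alpha.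
  by have [e Eje ne] := regE j Ej; exists j, e.
have [s sE] := spinal_group_fg E.
have Gs : G = generated [set` [seq (x ^ g)%g | x <- s]].
  by rewrite GE sE conjugate_generated.
have Ga : G (rooted_a p ^ g)%g.
  by rewrite GE; exists (rooted_a p) => //; apply: mem_generated; left.
(* Conjugation by [g^-1] lets [G] act on the tree through the group in standard form, and the
   conjugate of the rooted generator by [g] then acts as that generator. *)
have phi_bij : set_bij G (spinal_group E) (fun x => x ^ g^-1)%g.
  rewrite GE; split=> [_ [x Ex <-]|x y _ _ /conjg_inj //|x Ex].
    by rewrite conjgK.
  by exists (x ^ g)%g; [exists x | rewrite conjgK].
apply: (uncountable_weakly_maximal_orbits (prime_gt1 p_prime) Gs
  (branch_on_comp _ phi_bij _ (spinal_group_branch_on p_prime p_odd nonconst)) Ga).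
- by rewrite Gs; exact: generated_subgroup.
- by move=> x y _ _; exact: conjMg.
- by rewrite /= conjgK.
Qed.
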